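(* Let $\mathcal{A}$ be a unital $C^{*}$-algebra and let $M,N$ be two closed, orthogonally complementable submodules of $H_{\mathcal{A}}$ with $M\cap N=\{0\}$. Then $M+N$ is closed if and only if the Dixmier angle between $M$ and $N$ is positive.
   Context: $H_{\mathcal{A}}=l_2(\mathcal{A})$ is the standard (right) Hilbert $C^{*}$-module over $\mathcal{A}$ of sequences $(a_i)_{i\in\mathbb{N}}$ in $\mathcal{A}$ with $\sum_i a_i^{*}a_i$ norm-convergent. A closed submodule $X$ is orthogonally complementable if $H_{\mathcal{A}}=X\oplus X^{\perp}$. For closed submodules $M,N$ of $H_{\mathcal{A}}$ set $$c_0(M,N)=\sup\{\|\langle x,y\rangle\| \mid x\in M,\ y\in N,\ \|x\|,\|y\|\le 1\}.$$ The Dixmier angle between $M$ and $N$ is said to be positive if $c_0(M,N)<1$. *)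

(* Defs.v *)
From HB Require Import structures.
From mathcomp Require Import all_boot all_order all_algebra.
From mathcomp Require Import complex.
From mathcomp Require Import all_classical all_reals all_analysis.

Set Implicit Arguments.
Unset Strict Implicit.
Unset Printing Implicit Defensive.

Import Order.TTheory GRing.Theory Num.Theory.
Import numFieldNormedType.Exports.

Local Open Scope classical_set_scope.
Local Open Scope ring_scope.

Reserved Notation "a ** b" (at level 40, left associativity).

(* The product is part of the mixin, with the usual axioms of a unital
   associative algebra over R[i]: MathComp has no structure below numDomainType
   joining rings and normed modules, so that a type cannot be both an algType
   and a normedModType.
   The norm of a normedModType over R[i] is R[i]-valued, with values in the
   nonnegative reals, and the order of R[i] restricts to that of the reals. *)
HB.mixin Record isUnitalCStar (R : realType) A
    & CompleteNormedModule R[i] A := {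
  cmul : A -> A -> A;
  cone : A;
  star : A -> A;
  cmulA : associative cmul;
  cmul1l : left_id cone cmul;
  cmul1r : right_id cone cmul;
  cmulDl : left_distributive cmul +%R;
  cmulDr : right_distributive cmul +%R;
  cscaleAl : forall (k : R[i]) (a b : A), k *: cmul a b = cmul (k *: a) b;
  cscaleAr : forall (k : R[i]) (a b : A), k *: cmul a b = cmul a (k *: b);
  starK : involutive star;
  starD : {morph star : a b / a + b};
  starZ : forall (k : R[i]) (a : A), star (k *: a) = conjc k *: star a;
  starM : forall a b : A, star (cmul a b) = cmul (star b) (star a);
  norm_cmul_le : forall a b : A, `|cmul a b| <= `|a| * `|b|;
  norm_star_cmul : forall a : A, `|cmul (star a) a| = `|a| ^+ 2
}.

#[short(type="unitalCStarType")]
HB.structure Definition UnitalCStar (R : realType) :=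
  {A of isUnitalCStar R A & CompleteNormedModule R[i] A}.

Notation "a ** b" := (cmul a b) : ring_scope.

Section StandardHilbertModule.
Context {R : realType} {A : unitalCStarType R}.
Implicit Types (x y : nat -> A) (M N : set (nat -> A)).

Definition cnorm (a : A) : R := complex.Re `|a|.

Definition l2 : set (nat -> A) :=
  [set x : nat -> A | cvgn (fun n => \sum_(i < n) star (x i) ** x i)].

(* The series converges for x and y in l2; outside of l2, lim may be a dummy
   value. *)
Definition inner x y : A := limn (fun n => \sum_(i < n) star (x i) ** y i).

Definition l2norm x : R := Num.sqrt (cnorm (inner x x)).

(* Since A is unital, stability under the right action of A includes stability
   under complex scalars. *)
Definition submodule M : Prop :=
  [/\ M `<=` l2, M 0, (forall x y, M x -> M y -> M (x + y)) &
      forall x (a : A), M x -> M (fun i => x i ** a)].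

Definition norm_closed M : Prop :=
  forall x, l2 x ->
    (forall e : R, 0 < e -> exists2 y, M y & l2norm (x - y) < e) -> M x.

Definition closed_submodule M : Prop := submodule M /\ norm_closed M.

Definition sumset M N : set (nat -> A) := [set x + y | x in M & y in N].

Definition orthogonal M : set (nat -> A) :=
  [set y | l2 y /\ forall x, M x -> inner x y = 0].

Definition orthogonally_complementable M : Prop :=
  sumset M (orthogonal M) = l2 /\ M `&` orthogonal M = [set 0].

Definition c0 M N : R :=
  sup [set r | exists x y, [/\ M x, N y, l2norm x <= 1, l2norm y <= 1 &
                               r = cnorm (inner x y)]].

Definition positive_dixmier_angle M N : Prop := c0 M N < 1.

End StandardHilbertModule.

(* Main.v *)
From HB Require Import structures.
From mathcomp Require Import all_boot all_order all_algebra.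
From mathcomp Require Import complex.
From mathcomp Require Import all_classical all_reals all_analysis.
From mathcomp Require Import ring lra zify.
Require Import Defs.

Set Implicit Arguments.
Unset Strict Implicit.
Unset Printing Implicit Defensive.

Import Order.TTheory GRing.Theory Num.Theory.
Import numFieldNormedType.Exports.

Local Open Scope classical_set_scope.
Local Open Scope ring_scope.
Local Open Scope complex_scope.

(* Let P and Q be the projections onto M and N.  If c = c0(M,N) < 1, then
   |P y| <= c |y| on N, and x + y = (x + P y) + (y - P y) gives
   (1 - c^2) |y|^2 <= |x + y|^2, so that Cauchy sequences in M + N have Cauchy
   components.  Conversely, if M + N is closed, the open mapping argument gives
   k |y|^2 <= |x + y|^2 for some k > 0.  A lower bound on the norm of
   <y - P y, y - P y> does not directly bound the norm of
   <P y, P y> = <y, y> - <y - P y, y - P y>.  Instead let v_0 = y, v_1 = P y,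
   v_2 = Q P y, ... be the alternating projections.  The A-valued sequence
   a_n = <v_n, v_n> is decreasing and convex, so n (a_n - a_(n+1)) <= a_0, while
   |a_n - a_(n+1)| >= k |a_n| for even n; hence |a_n| <= |a_0| / (n k), and the
   logarithmic convexity of |a_n| yields |a_1| <= r |a_0| with r < 1.

   The order on A rests on a^* a >= 0, which needs no spectral theory: if
   h = a^* a has norm at most 1 and q = 1 - h / 2, then the elements h q^(2n) are
   bounded uniformly in n, and this forces |q| <= 1. *)

(** Ring notation for [cmul]; the ring may be zero, as [A] may satisfy [1 = 0]. *)
#[non_forgetful_inheritance]
HB.instance Definition _ (R : realType) (A : unitalCStarType R) :=
  GRing.Zmodule_isPzRing.Build A (@cmulA R A) (@cmul1l R A) (@cmul1r R A)
    (@cmulDl R A) (@cmulDr R A).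

Lemma subrACA (V : zmodType) (a b c d : V) :
  a - b - (c - d) = (a - c) - (b - d).
Proof. by rewrite !opprB [LHS]addrACA [RHS]addrACA [- b - c]addrC. Qed.

(** If [a > b > 0], the powers of [a / b] would grow at most linearly, whereas Bernoulli's
    inequality, squared, makes them grow quadratically. *)
Lemma exp_le_linear_exp (R : realType) (a b c : R) :
  0 <= a -> 0 <= b -> (forall n, a ^+ n <= c * n.+1%:R * b ^+ n) -> a <= b.
Proof.
move=> a0 b0 H; rewrite leNgt; apply/negP => ba.
have [b1|b1] := eqVneq b 0.
  have := H 1; rewrite b1 expr1 expr1 mulr0 => ?; lra.
have bp : 0 < b by rewrite lt_def b1.
pose d := a / b - 1.
have dp : 0 < d by rewrite /d subr_gt0 ltr_pdivlMr // mul1r.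
have H2 n : (1 + d) ^+ n <= c * n.+1%:R.
  rewrite /d addrC subrK expr_div_n ler_pdivrMr ?exprn_gt0 //.
have bern n : 1 + n%:R * d <= (1 + d) ^+ n.
  elim: n => [|n IH]; first by rewrite mul0r addr0 expr0.
  rewrite exprS; apply: le_trans (ler_wpM2l _ IH); last lra.
  rewrite -natr1; have : 0 <= n%:R :> R by []. nra.
(* The exponent is [2 (n + 1)], and [2 (n + 1) + 1 <= 3 (n + 1)]. *)
have H3 n : (n.+1%:R * d) ^+ 2 <= c * 3 * n.+1%:R.
  have h1 := bern n.+1; have h2 := H2 (n.+1 * 2)%N; rewrite exprM in h2.
  have n0 : 0 <= n%:R :> R by [].
  have c0 : 0 < c by have := H2 0; rewrite expr0; lra.
  have : (n.+1%:R * d) ^+ 2 <= ((1 + d) ^+ n.+1) ^+ 2.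
    rewrite ler_pXn2r ?nnegrE ?mulr_ge0 ?exprn_ge0 //; lra.
  move/le_trans; apply; apply: (le_trans h2).
  rewrite -mulrA ler_wpM2l //; first lra.
  by rewrite -natrM ler_nat; lia.
pose N := Num.bound (`|c * 3 / d ^+ 2|).
have := archi_boundP (normr_ge0 (c * 3 / d ^+ 2)); rewrite -/N => hN.
have := H3 N.
rewrite exprMn expr2 -!mulrA [leRHS]mulrC -[leRHS]mulrA [leRHS]mulrCA => h.
have {}h : N.+1%:R * d ^+ 2 <= 3 * c.
  by rewrite -(ler_pM2l (_ : 0 < N.+1%:R)) // (le_trans h) // mulrC.
have : `|c * 3 / d ^+ 2| < N.+1%:R by rewrite (lt_trans hN) // ltr_nat.
rewrite ltNge => /negP; apply; rewrite (le_trans _ (ler_norm _)) //.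
by rewrite ler_pdivlMr ?exprn_gt0 // (le_trans h) // mulrC.
Qed.

(** * Norm and involution of a C*-algebra *)

Section CStar.
Context {R : realType} {A : unitalCStarType R}.
Implicit Types (a b c h x y : A) (k w : R[i]) (s t B : R).

Lemma norm_cnorm a : `|a| = (cnorm a)%:C.
Proof.
by rewrite /cnorm RRe_real // realE normr_ge0.
Qed.

Lemma cnorm_ge0 a : 0 <= cnorm a.
Proof. by rewrite -lecR -norm_cnorm normr_ge0. Qed.
Hint Resolve cnorm_ge0 : core.

Lemma cnormD a b : cnorm (a + b) <= cnorm a + cnorm b.
Proof. by rewrite -lecR rmorphD /= -!norm_cnorm; exact: ler_normD. Qed.

Lemma cnormN a : cnorm (- a) = cnorm a.
Proof. by rewrite /cnorm normrN. Qed.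

Lemma cnormB a b : cnorm (a - b) <= cnorm a + cnorm b.
Proof. by rewrite -[in leRHS](cnormN b) cnormD. Qed.

Lemma cdistC a b : cnorm (a - b) = cnorm (b - a).
Proof. by rewrite /cnorm distrC. Qed.

Lemma cnorm_lerB a b : cnorm a - cnorm b <= cnorm (a - b).
Proof. by rewrite lerBlDr -[in leLHS](subrK b a) cnormD. Qed.

Lemma cnorm0 : cnorm (0 : A) = 0.
Proof. by rewrite /cnorm normr0. Qed.

Lemma cnorm_eq0 a : (cnorm a == 0) = (a == 0).
Proof.
rewrite -[RHS]normr_eq0 norm_cnorm; apply/eqP/eqP => [->//|].
by move/complexI.
Qed.

Lemma cnorm_gt0 a : (0 < cnorm a) = (a != 0).
Proof. by rewrite lt_def cnorm_ge0 andbT cnorm_eq0. Qed.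

Lemma cnormZ k a : (cnorm (k *: a))%:C = `|k| * (cnorm a)%:C.
Proof. by rewrite -!norm_cnorm normrZ. Qed.

Lemma cnormZr t a : cnorm (t%:C *: a) = `|t| * cnorm a.
Proof. by apply: complexI; rewrite cnormZ rmorphM /= normc_def /= expr0n addr0 sqrtr_sqr. Qed.

Lemma cnormZ1 w a : `|w| = 1 -> cnorm (w *: a) = cnorm a.
Proof. by move=> w1; apply: complexI; rewrite cnormZ w1 mul1r. Qed.

Lemma cnorm_mul a b : cnorm (a * b) <= cnorm a * cnorm b.
Proof. by rewrite -lecR rmorphM /= -!norm_cnorm norm_cmul_le. Qed.

Lemma cnorm_starM a : cnorm (star a * a) = cnorm a ^+ 2.
Proof. by apply: complexI; rewrite rmorphXn /= -!norm_cnorm norm_star_cmul. Qed.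

Lemma cnorm_star a : cnorm (star a) = cnorm a.
Proof.
have H b : cnorm b <= cnorm (star b).
  have [->|b0] := eqVneq b 0; first by rewrite cnorm0.
  rewrite -(ler_pM2r (_ : 0 < cnorm b)) ?cnorm_gt0 // -expr2 -cnorm_starM.
  exact: cnorm_mul.
by apply/eqP; rewrite eq_le H -{2}(starK a) H.
Qed.

Lemma star0 : star (0 : A) = 0.
Proof. by apply: (addrI (star 0)); rewrite -starD !addr0. Qed.

Lemma starN a : star (- a) = - star a.
Proof. by apply: (addrI (star a)); rewrite -starD !subrr star0. Qed.

Lemma starB a b : star (a - b) = star a - star b.
Proof. by rewrite starD starN. Qed.

Lemma star_mul a b : star (a * b) = star b * star a.
Proof. exact: starM. Qed.

Lemma star1 : star (1 : A) = 1.
Proof. by rewrite -[LHS]mulr1 -{2}(starK 1) -star_mul mulr1 starK. Qed.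

Lemma conjc_real t : conjc (t%:C) = t%:C.
Proof. by rewrite /= oppr0. Qed.

Lemma starZr t a : star (t%:C *: a) = t%:C *: star a.
Proof. by rewrite starZ conjc_real. Qed.

Lemma starX a n : star (a ^+ n) = star a ^+ n.
Proof. by elim: n => [|n IH]; rewrite ?star1 // exprS star_mul IH -exprSr. Qed.

Lemma add_self a : a + a = (2 : R)%:C *: a.
Proof. by rewrite rmorphMn /= scaler_nat mulr2n. Qed.

Lemma scalelM k a b : (k *: a) * b = k *: (a * b).
Proof. by rewrite -[RHS]/(k *: cmul a b) cscaleAl. Qed.

Lemma scalerM k a b : a * (k *: b) = k *: (a * b).
Proof. by rewrite -[RHS]/(k *: cmul a b) cscaleAr. Qed.

Lemma exprZ k a n : (k *: a) ^+ n = k ^+ n *: a ^+ n.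
Proof.
elim: n => [|n IH]; first by rewrite !expr0 scale1r.
by rewrite !exprS IH scalelM scalerM scalerA.
Qed.

Lemma cnorm1_le : cnorm (1 : A) <= 1.
Proof.
have := cnorm_starM 1; rewrite star1 mulr1 => h.
have := cnorm_ge0 1; nra.
Qed.

(** The nonzero [a] excludes the zero algebra, where this norm is 0. *)
Lemma cnorm1 a : a != 0 -> cnorm (1 : A) = 1.
Proof.
move=> a0; apply/eqP; rewrite eq_le cnorm1_le /=.
rewrite -(ler_pM2r (_ : 0 < cnorm a)) ?cnorm_gt0 // mul1r -{1}[a]mul1r.
exact: cnorm_mul.
Qed.

Lemma cnormX_le a n : (0 < n)%N -> cnorm (a ^+ n) <= cnorm a ^+ n.
Proof.
case: n => // n _; elim: n => [//|n IH].
by rewrite exprS [leRHS]exprS (le_trans (cnorm_mul _ _)) // ler_wpM2l.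
Qed.

Lemma cnorm_sq a : star a = a -> cnorm (a ^+ 2) = cnorm a ^+ 2.
Proof. by move=> sa; rewrite -cnorm_starM sa. Qed.

(** The C*-identity gives equality at the exponents [2 ^ m]. Otherwise multiply up to [2 ^ n.+1] and
    cancel the surplus factor by submultiplicativity. *)
Lemma cnormX_ge a n : star a = a -> cnorm a ^+ n.+1 <= cnorm (a ^+ n.+1).
Proof.
move=> sa.
have pow2 m : cnorm (a ^+ (2 ^ m)) = cnorm a ^+ (2 ^ m).
  elim: m => [|m IH]; first by rewrite !expr1.
  by rewrite expnS mulnC !exprM cnorm_sq ?starX ?sa // IH.
have [->|a0] := eqVneq a 0; first by rewrite cnorm0 !expr0n cnorm0.
have ap : 0 < cnorm a by rewrite cnorm_gt0.
have h : (n.+1 < 2 ^ n.+1)%N by rewrite ltn_expl.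
have := pow2 n.+1; rewrite -(subnKC (ltnW h)) exprD [RHS]exprD.
rewrite -(ler_pM2r (exprn_gt0 (2 ^ n.+1 - n.+1) ap)) => <-.
rewrite (le_trans (cnorm_mul _ _)) // ler_wpM2l // cnormX_le //.
by rewrite subn_gt0.
Qed.

End CStar.

(** * Norm estimates for self-adjoint elements *)

Section SelfAdjointNorm.
Context {R : realType} {A : unitalCStarType R}.
Implicit Types (a b c h x y : A) (k w : R[i]) (s t B : R).

Lemma sum_double (V : zmodType) (F : nat -> V) n :
  \sum_(i < n.*2) F i = \sum_(i < n) (F i.*2 + F i.*2.+1).
Proof.
elim: n => [|n IH]; first by rewrite !big_ord0.
by rewrite doubleS !big_ord_recr /= IH addrA.
Qed.

Lemma unit_sqrt w : `|w| = 1 -> exists2 u, `|u| = 1 & u ^+ 2 = w.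
Proof.
move=> w1; exists (sqrtC w); last exact: sqrtCK.
have : `|sqrtC w| ^+ 2 == 1 by rewrite -normrX sqrtCK w1.
by rewrite sqrp_eq1 // => /eqP.
Qed.

(* Cauchy's estimate for polynomials bounded on the unit circle; replacing [w]
   by [- w] separates even and odd coefficients. *)
Lemma coef_bound_pow2 m (c : nat -> A) B :
  (forall w, `|w| = 1 -> cnorm (\sum_(j < 2 ^ m) w ^+ j *: c j) <= B) ->
  forall j, (j < 2 ^ m)%N -> cnorm (c j) <= B.
Proof.
elim: m c => [|m IH] c H j.
  have := H 1 (normr1 _); rewrite big_ord1 scale1r.
  by case: j.
have split_sum w : \sum_(j < 2 ^ m.+1) w ^+ j *: c j =
    \sum_(j < 2 ^ m) (w ^+ 2) ^+ j *: c j.*2 +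
    w *: \sum_(j < 2 ^ m) (w ^+ 2) ^+ j *: c j.*2.+1.
  rewrite expnS mul2n (sum_double (fun j => w ^+ j *: c j)) big_split /=.
  rewrite scaler_sumr; congr (_ + _); apply: eq_bigr => i _.
    by rewrite -exprM mul2n.
  by rewrite scalerA -exprM mul2n exprS.
have half (P Q : A) : cnorm (P + Q) <= B -> cnorm (P - Q) <= B ->
    cnorm P <= B /\ cnorm Q <= B.
  move=> h1 h2.
  have eP : (2 : R)%:C *: P = (P + Q) + (P - Q).
    by rewrite addrACA subrr addr0 add_self.
  have eQ : (2 : R)%:C *: Q = (P + Q) - (P - Q).
    by rewrite opprB [_ + (Q - P)]addrC addrA subrK add_self.
  have n2 (X : A) : cnorm ((2 : R)%:C *: X) = 2 * cnorm X.
    by rewrite cnormZr ger0_norm.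
  have := cnormD (P + Q) (P - Q); have := cnormB (P + Q) (P - Q).
  rewrite -eP -eQ !n2; split; lra.
have evodd w : `|w| = 1 -> cnorm (\sum_(j < 2 ^ m) w ^+ j *: c j.*2) <= B /\
    cnorm (\sum_(j < 2 ^ m) w ^+ j *: c j.*2.+1) <= B.
  move=> /unit_sqrt[u u1 <-].
  have h1 := H u u1; have := H (- u); rewrite normrN => /(_ u1).
  rewrite split_sum sqrrN scaleNr; rewrite split_sum in h1 => h2.
  by have := half _ _ h1 h2; rewrite cnormZ1.
move=> hj; rewrite -(odd_double_half j).
have hh : (j./2 < 2 ^ m)%N by rewrite ltn_half_double -mul2n -expnS.
case: (odd j); rewrite ?add0n ?add1n.
  by apply: (IH (fun i => c i.*2.+1)) => // w /evodd[].
by apply: (IH (fun i => c i.*2)) => // w /evodd[].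
Qed.

Lemma coef_bound n (c : nat -> A) B :
  (forall w, `|w| = 1 -> cnorm (\sum_(j < n) w ^+ j *: c j) <= B) ->
  forall j, (j < n)%N -> cnorm (c j) <= B.
Proof.
move=> H j jn.
have nn : (n <= 2 ^ n)%N by rewrite ltnW // ltn_expl.
(* Zero padding brings the length to a power of two. *)
pose c' i := if (i < n)%N then c i else 0.
have := @coef_bound_pow2 n c' B _ j; rewrite /c' jn; apply; last first.
  exact: leq_trans nn.
move=> w /H; rewrite (big_ord_widen _ (fun j => w ^+ j *: c j) nn).
rewrite big_mkcond /=; congr (cnorm _ <= _).
by apply: eq_bigr => i _; case: ifP; rewrite ?scaler0.
Qed.

Definition sca t : A := t%:C *: cone.

Lemma sca1 : sca 1 = 1.
Proof. exact: scale1r. Qed.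

Lemma star_sca t : star (sca t) = sca t.
Proof. by rewrite starZr star1. Qed.

Lemma sca_mul t x : sca t * x = t%:C *: x.
Proof. by rewrite scalelM mul1r. Qed.

Lemma mul_sca t x : x * sca t = t%:C *: x.
Proof. by rewrite scalerM mulr1. Qed.

Lemma scaD s t : sca (s + t) = sca s + sca t.
Proof. by rewrite /sca rmorphD scalerDl. Qed.

Lemma scaN t : sca (- t) = - sca t.
Proof. by rewrite /sca rmorphN scaleNr. Qed.

Lemma scaB s t : sca (s - t) = sca s - sca t.
Proof. by rewrite scaD scaN. Qed.

Lemma scaM s t : sca (s * t) = sca s * sca t.
Proof. by rewrite sca_mul scalerA -rmorphM. Qed.

Lemma cnorm_sca t : cnorm (sca t) <= `|t|.
Proof. by rewrite cnormZr -[leRHS]mulr1 ler_wpM2l // cnorm1_le. Qed.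

(* MathComp evaluates polynomials only in algebras with [1 != 0]. *)
Definition ev x (p : {poly R[i]}) : A := \sum_(i < size p) p`_i *: x ^+ i.

Lemma ev_wide n x (p : {poly R[i]}) : (size p <= n)%N ->
  ev x p = \sum_(i < n) p`_i *: x ^+ i.
Proof.
move=> h; rewrite /ev (big_ord_widen _ (fun i => p`_i *: x ^+ i) h) big_mkcond /=.
apply: eq_bigr => i _; case: ltnP => // /(nth_default 0) ->.
by rewrite scale0r.
Qed.

Lemma evD x (p q : {poly R[i]}) : ev x (p + q) = ev x p + ev x q.
Proof.
rewrite (ev_wide x (size_polyD p q)) (ev_wide x (leq_maxl (size p) (size q))).
rewrite (ev_wide x (leq_maxr (size p) (size q))) -big_split /=.
by apply: eq_bigr => i _; rewrite coefD scalerDl.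
Qed.

Lemma evZ x k (p : {poly R[i]}) : ev x (k *: p) = k *: ev x p.
Proof.
rewrite (ev_wide x (size_scale_leq k p)) scaler_sumr.
by apply: eq_bigr => i _; rewrite coefZ scalerA.
Qed.

Lemma evN x (p : {poly R[i]}) : ev x (- p) = - ev x p.
Proof. by rewrite -scaleN1r evZ scaleN1r. Qed.

Lemma ev_sca x t : ev x (t%:C)%:P = sca t.
Proof. by rewrite (ev_wide x (size_polyC_leq1 _)) big_ord1 coefC. Qed.

Lemma evMX x (p : {poly R[i]}) : ev x (p * 'X) = ev x p * x.
Proof.
have h : (size (p * 'X)%R <= (size p).+1)%N.
  by rewrite (leq_trans (size_polyMleq _ _)) // size_polyX addn2.
rewrite (ev_wide x h) big_ord_recl coefMX scale0r add0r mulr_suml.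
by apply: eq_bigr => i _; rewrite coefMX /= scalelM exprSr.
Qed.

Lemma evM x (p q : {poly R[i]}) : ev x (p * q) = ev x p * ev x q.
Proof.
elim/poly_ind: q => [|q c IH].
  have ev0 : ev x 0 = 0 by rewrite /ev size_poly0 big_ord0.
  by rewrite mulr0 ev0 mulr0.
rewrite mulrDr mulrA !evD !evMX IH mulrDr mulrA; congr (_ + _).
rewrite mulrC mul_polyC evZ (ev_wide x (size_polyC_leq1 _)) big_ord1 coefC /=.
by rewrite scalerM mulr1.
Qed.

Lemma ev1 x : ev x 1 = 1.
Proof. by rewrite -polyC1 (ev_sca x 1) sca1. Qed.

Lemma evX x : ev x 'X = x.
Proof. by rewrite -['X]mul1r evMX ev1 mul1r. Qed.

Lemma evXn x (p : {poly R[i]}) n : ev x (p ^+ n) = ev x p ^+ n.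
Proof. by elim: n => [|n IH]; rewrite ?ev1 // !exprS evM IH. Qed.

Definition evE := (evXn, evD, evM, evN, evZ, ev1, ev_sca, evX).

(* [(t + w x)^* (t + w x)] is a convex combination of [(t + x)^2] and
   [(t - x)^2]. *)
Lemma cnorm_circle t x w B : star x = x -> `|w| = 1 ->
  cnorm (sca t + x) <= B -> cnorm (sca t - x) <= B ->
  cnorm (sca t + w *: x) <= B.
Proof.
move=> sx w1 h1 h2.
have B0 : 0 <= B := le_trans (cnorm_ge0 _) h1.
have wE : w * conjc w = 1 by rewrite -normCK w1 expr1n.
(* The weight of the convex combination: [cos^2 (u / 2)] for [w = exp (i u)]. *)
pose r := (1 + complex.Re w) / 2.
have rle : `|complex.Re w| <= 1.
  rewrite -lecR (le_trans _ (_ : `|w| <= _)) ?w1 //.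
  by rewrite -w1 normc_def lecR -sqrtr_sqr ler_wsqrtr // lerDl sqr_ge0.
have r01 : 0 <= r <= 1 by move: rle; rewrite ler_norml /r; lra.
have wS : w + conjc w = (4 * r - 2)%:C.
  case: w @r {w1 wE rle r01} => p q r.
  by apply/eqP; rewrite eq_complex /=; apply/andP; split; apply/eqP; rewrite /r /=; field.
have e1 : star (sca t + w *: x) * (sca t + w *: x) =
   r%:C *: (sca t + x) ^+ 2 + (1 - r)%:C *: (sca t - x) ^+ 2.
  rewrite starD star_sca starZ sx.
  (* Only powers of [x] occur, so [ring] can prove the identity for commuting polynomials before it
     is evaluated at [x]. *)
  have : (t%:C%:P + conjc w *: 'X) * (t%:C%:P + w *: 'X) =
      r%:C *: (t%:C%:P + 'X) ^+ 2 + (1 - r)%:C *: (t%:C%:P - 'X) ^+ 2.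
    rewrite -!mul_polyC; set T := t%:C%:P; set W := w%:P; set W' := (conjc w)%:P.
    have EW : W * W' = 1 by rewrite -polyCM wE.
    have ES : W + W' = 4 * r%:C%:P - 2.
      rewrite -polyCD wS (rmorphB (real_complex R)) (rmorphM (real_complex R)).
      by rewrite !(rmorph_nat (real_complex R)) polyCB polyCM !polyC_natr.
    rewrite (_ : _ * _ = T ^+ 2 + (W + W') * T * 'X + (W * W') * 'X ^+ 2); last by ring.
    have E1 : (1 - r)%:C%:P = 1 - r%:C%:P :> {poly R[i]}.
      by rewrite (rmorphB (real_complex R)) (rmorph1 (real_complex R)) polyCB.
    rewrite EW ES E1; ring.
  by move/(congr1 (ev x)); rewrite !evE.
have sq y : cnorm y <= B -> cnorm (y ^+ 2) <= B ^+ 2.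
  move=> yB; rewrite (le_trans (cnormX_le _ _)) //.
  by rewrite ler_pXn2r ?nnegrE ?cnorm_ge0.
have : cnorm (sca t + w *: x) ^+ 2 <= B ^+ 2.
  rewrite -cnorm_starM e1 (le_trans (cnormD _ _)) // !cnormZr.
  have := sq _ h1; have := sq _ h2.
  rewrite !ger0_norm; [nra|lra|lra].
by rewrite ler_pXn2r ?nnegrE ?cnorm_ge0.
Qed.

(* All coefficients of [(t + w x)^n] have norm at most [B^n], and summing them
   gives [(t + cnorm x)^n <= (n + 1) B^n]. *)
Lemma cnorm_selfadjoint t x B : star x = x -> 0 <= t -> x != 0 ->
  cnorm (sca t + x) <= B -> cnorm (sca t - x) <= B -> t + cnorm x <= B.
Proof.
move=> sx t0 x0 h1 h2.
have B0 : 0 <= B := le_trans (cnorm_ge0 _) h1.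
apply: (@exp_le_linear_exp _ _ _ 1) => // [|n]; first by rewrite addr_ge0 ?cnorm_ge0.
rewrite mul1r.
have H j : (j < n.+1)%N -> t ^+ (n - j) * cnorm x ^+ j *+ 'C(n, j) <= B ^+ n.
  move=> jn.
  pose c j := (t ^+ (n - j) *+ 'C(n, j))%:C *: x ^+ j.
  have : cnorm (c j) <= B ^+ n.
    apply: (@coef_bound n.+1) => // w w1.
    rewrite (_ : \sum_(_ < _) _ = (sca t + w *: x) ^+ n).
      case: n {c jn} => [|n]; first by rewrite !expr0 cnorm1_le.
      rewrite (le_trans (cnormX_le _ _)) // ler_pXn2r ?nnegrE ?cnorm_ge0 //.
      exact: cnorm_circle.
    rewrite exprDn_comm; last by rewrite /GRing.comm sca_mul mul_sca.
    apply: eq_bigr => i _; rewrite /c /sca !exprZ expr1n scalelM mul1r !scalerA.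
    by rewrite rmorphMn rmorphXn /= scalerMnl mulrnAr mulrC.
  apply: le_trans; rewrite /c cnormZr ger0_norm ?mulrn_wge0 ?exprn_ge0 //.
  rewrite mulrnAl ler_wMn2r // ler_wpM2l ?exprn_ge0 //.
  case: j {c jn} => [|j]; last exact: cnormX_ge.
  by rewrite !expr0 (cnorm1 x0).
rewrite exprDn (le_trans (ler_sum _ (fun (i : 'I_n.+1) _ => H i (ltn_ord i)))) //.
by rewrite sumr_const card_ord mulr_natl.
Qed.
End SelfAdjointNorm.

(** * Positive elements and the order *)

Section Positivity.
Context {R : realType} {A : unitalCStarType R}.
Implicit Types (a b c h k x y : A) (s t B d : R).

(* [h] is self-adjoint with nonnegative spectrum iff [`|t - h| - t], which is
   nonincreasing in [t], has a nonpositive limit. *)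
Definition pos h : Prop :=
  star h = h /\ forall d, 0 < d -> exists2 t, 0 <= t & cnorm (sca t - h) <= t + d.

(** For [x = - h] this is the monotonicity of [|t - h| - t] in [t]. *)
Lemma cnorm_shift s t x : 0 <= s -> cnorm (sca (t + s) + x) <= cnorm (sca t + x) + s.
Proof.
move=> s0; rewrite scaD addrAC (le_trans (cnormD _ _)) // lerD2l.
by rewrite (le_trans (cnorm_sca _)) // ger0_norm.
Qed.

Lemma posD h k : pos h -> pos k -> pos (h + k).
Proof.
move=> [sh hp] [sk kp]; split; first by rewrite starD sh sk.
move=> d d0; have d2 : 0 < d / 2 by lra.
have [s s0 hs] := hp _ d2; have [t t0 ht] := kp _ d2.
exists (s + t); first by rewrite addr_ge0.
rewrite scaD opprD addrACA (le_trans (cnormD _ _)) //; lra.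
Qed.

Lemma posZ t h : 0 <= t -> pos h -> pos (t%:C *: h).
Proof.
move=> t0 [sh hp]; split; first by rewrite starZr sh.
move=> d d0; have [->|tn0] := eqVneq t 0.
  by exists 0 => //; rewrite scale0r subr0 (le_trans (cnorm_sca _)) // normr0 add0r ltW.
have tp : 0 < t by rewrite lt_def tn0.
have [s s0 hs] := hp (d / t) (divr_gt0 d0 tp).
exists (t * s); first exact: mulr_ge0.
rewrite scaM sca_mul -scalerBr cnormZr (gtr0_norm tp).
by rewrite (le_trans (ler_wpM2l t0 hs)) // mulrDr mulrCA divff // mulr1.
Qed.

Lemma pos_closed h : star h = h ->
  (forall d, 0 < d -> exists2 k, pos k & cnorm (h - k) <= d) -> pos h.
Proof.
move=> sh H; split=> // d d0; have d2 : 0 < d / 2 by lra.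
have [k [_ kp] hk] := H _ d2; have [t t0 ht] := kp _ d2.
exists t => //; rewrite (_ : _ - h = (sca t - k) - (h - k)).
  rewrite (le_trans (cnormB _ _)) //; lra.
by rewrite opprB addrA subrK.
Qed.

Lemma pos_sca_sub t h : star h = h -> cnorm h <= t -> pos (sca t - h).
Proof.
move=> sh ht; split; first by rewrite starB star_sca sh.
move=> d d0; exists t; first exact: le_trans (cnorm_ge0 _) ht.
rewrite opprB addrC subrK; lra.
Qed.

(** Turns [h <= s] into norm bounds at all large [u], so that the bounds for [h] and [- h] can be
    used at a common [u]. *)
Lemma pos_sub_le h s : pos (sca s - h) -> forall d, 0 < d ->
  exists2 t, 0 <= t & forall u, t <= u -> cnorm (sca u + h) <= u + s + d.
Proof.
move=> [_ H] d d0; have [t t0 ht] := H d d0.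
exists (Num.max 0 (t - s)); first by rewrite le_max lexx.
move=> u; rewrite ge_max => /andP[u0 tu].
have us : 0 <= u + s - t by lra.
have := cnorm_shift (t - s) h us.
have -> : t - s + (u + s - t) = u by ring.
move=> /le_trans; apply.
move: ht; rewrite opprB addrCA -scaB addrC => ht; lra.
Qed.

(** From [- s <= h <= s], both [|u + h|] and [|u - h|] are at most [u + s + d] for some [u], and
    [cnorm_selfadjoint] gives [u + |h| <= u + s + d]. *)
Lemma cnorm_le_pos s h : star h = h -> 0 <= s -> pos (sca s - h) -> pos (sca s + h) ->
  cnorm h <= s.
Proof.
move=> sh s0 p1 p2.
have [->|h0] := eqVneq h 0; first by rewrite cnorm0.
apply/ler_addgt0Pr => d d0.
have [t1 t10 H1] := pos_sub_le p1 d0.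
rewrite -[h in sca s + h]opprK in p2.
have [t2 t20 H2] := pos_sub_le p2 d0.
pose u := t1 + t2.
have u0 : 0 <= u by rewrite addr_ge0.
have := cnorm_selfadjoint sh u0 h0 (H1 u _) (H2 u _).
rewrite lerDl lerDr => /(_ t20 t10); lra.
Qed.

(** Since [0 <= h <= h + k <= |h + k|]. Order relations become norm inequalities through this
    lemma. *)
Lemma cnorm_pos_mono h k : pos h -> pos k -> cnorm h <= cnorm (h + k).
Proof.
move=> ph pk; have [sh _] := ph; have [sk _] := pk.
apply: cnorm_le_pos => //; first exact: cnorm_ge0.
  rewrite (_ : _ - h = (sca (cnorm (h + k)) - (h + k)) + k).
    by apply: posD => //; apply: pos_sca_sub => //; rewrite starD sh sk.
  by rewrite opprD addrA subrK.
apply: posD => //; rewrite -[sca _]subr0; apply: pos_sca_sub; first exact: star0.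
by rewrite cnorm0 cnorm_ge0.
Qed.

(* [1 - y^2 / 2] is the real part of the almost unitary element
   [1 - y^2 / 2 + i y]. *)
Lemma cnorm_sub_sq y : star y = y ->
  cnorm (1 - (2^-1)%:C *: y ^+ 2) <= 1 + cnorm y ^+ 4 / 8.
Proof.
move=> sy; pose c := 1 - (2^-1)%:C *: y ^+ 2.
have sc : star c = c by rewrite starB star1 starZr starX sy.
pose v := c + 'i *: y.
have ci : conjc 'i = - 'i :> R[i] by exact: conjCi.
have sv : star v = c - 'i *: y by rewrite starD starZ sc sy ci scaleNr.
have vv : star v * v = 1 + (4^-1)%:C *: y ^+ 4.
  rewrite sv.
  have : (1 - (2^-1)%:C *: 'X ^+ 2 - 'i *: 'X) * (1 - (2^-1)%:C *: 'X ^+ 2 + 'i *: 'X)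
     = 1 + (4^-1)%:C *: 'X ^+ 4 :> {poly R[i]}.
    rewrite -!mul_polyC; set H := (2^-1)%:C%:P; set I := 'i%:P.
    have EI : I ^+ 2 = -1 by rewrite -polyC_exp sqrCi polyCN.
    have EH : H *+ 2 = 1.
      rewrite -polyCMn -(rmorphMn (real_complex R)).
      have -> : 2^-1 *+ 2 = 1 :> R by lra.
      by rewrite (rmorph1 (real_complex R)).
    have EQ : (4^-1)%:C%:P = H ^+ 2.
      by rewrite -polyC_exp -(rmorphXn (real_complex R)) exprVn -natrX.
    rewrite (_ : _ * _ =
      1 - (H *+ 2) * 'X ^+ 2 + H ^+ 2 * 'X ^+ 4 - I ^+ 2 * 'X ^+ 2); last by ring.
    rewrite EI EQ EH; ring.
  by move/(congr1 (ev y)); rewrite !evE.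
have y4 : cnorm (y ^+ 4) <= cnorm y ^+ 4 by rewrite cnormX_le.
have v2 : cnorm v ^+ 2 <= 1 + cnorm y ^+ 4 / 4.
  rewrite -cnorm_starM vv (le_trans (cnormD _ _)) // lerD ?cnorm1_le //.
  by rewrite cnormZr ger0_norm ?invr_ge0 // mulrC ler_pdivrMr // mulfVK.
have v1 : cnorm v <= 1 + cnorm y ^+ 4 / 8.
  have y0 : 0 <= cnorm y ^+ 4 by rewrite exprn_ge0 ?cnorm_ge0.
  have := cnorm_ge0 v; nra.
have : 2 * cnorm c <= 2 * cnorm v.
  have -> : 2 * cnorm c = cnorm (star v + v).
    rewrite sv /v addrACA addNr addr0 add_self.
    by rewrite cnormZr ger0_norm.
  by rewrite (le_trans (cnormD _ _)) // cnorm_star; lra.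
rewrite -/c; lra.
Qed.

Lemma pos_sq x : star x = x -> pos (x ^+ 2).
Proof.
move=> sx; split; first by rewrite starX sx.
move=> d d0.
(* For [y = sqrt (2 / n) x], [cnorm_sub_sq] multiplied by [n] reads
   [|n - x^2| <= n + |x|^4 / (2 n)], and this [n] makes the error at most [d]. *)
pose n := cnorm x ^+ 4 / (2 * d) + 1.
have n1 : 1 <= n.
  by rewrite /n lerDr divr_ge0 ?exprn_ge0 ?cnorm_ge0 //; lra.
have np : 0 < n by lra.
exists n => //; first lra.
pose e := Num.sqrt (2 / n).
have e2 : e ^+ 2 = 2 / n by rewrite sqr_sqrtr // divr_ge0 //; lra.
have := @cnorm_sub_sq (e%:C *: x); rewrite starZr sx => /(_ erefl).
rewrite exprZ scalerA -rmorphXn -rmorphM /= e2 cnormZr mulrA mulVf // mul1r.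
rewrite ger0_norm ?sqrtr_ge0 // exprMn (exprM _ 2 2) e2 => h.
have : n * cnorm (1 - (n^-1)%:C *: x ^+ 2) <= n + d.
  apply: (le_trans (ler_wpM2l (ltW np) h)).
  rewrite mulrDr mulr1 lerD2l.
  have -> : n * ((2 / n) ^+ 2 * cnorm x ^+ (2 * 2) / 8) = (cnorm x ^+ 4 / 2) / n.
    by field; rewrite gt_eqF.
  rewrite ler_pdivrMr // /n mulrDr mulrCA.
  have -> : cnorm x ^+ 4 * (d / (2 * d)) = cnorm x ^+ 4 / 2 by field; rewrite ?gt_eqF.
  by rewrite mulr1 lerDl ltW.
rewrite -{1}(gtr0_norm np) -cnormZr scalerBr scalerA -rmorphM divff ?gt_eqF //.
by rewrite scale1r.
Qed.

End Positivity.

(** * Positivity of [a^* a] *)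

Section StarSquares.
Context {R : realType} {A : unitalCStarType R}.
Implicit Types (a b c h k x y : A) (s t B d : R).

(** The self-adjoint elements [x = b + b^*] and [y = i (b - b^* )] satisfy
    [x^2 + y^2 = 2 (b^* b + b b^* )]. *)
Lemma pos_star_add b : pos (star b * b + b * star b).
Proof.
pose y := 'i *: (b - star b).
have sx : star (b + star b) = b + star b by rewrite starD starK addrC.
have sy : star y = y.
  have ci : conjc 'i = - 'i :> R[i] by exact: conjCi.
  by rewrite /y starZ ci starB starK scaleNr -scalerN opprB.
have := posD (pos_sq sx) (pos_sq sy).
rewrite /y exprZ sqrCi scaleN1r.
have -> : (b + star b) ^+ 2 - (b - star b) ^+ 2 =
    (star b * b + b * star b) + (star b * b + b * star b).
  rewrite !expr2 !mulrDl !mulrDr !mulNr !mulrN opprK.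
  rewrite ![b * b + _ + (_ + _)](AC (2*2) ((1*4)*(2*3))) /=.
  by rewrite [- (_ + (- _ - _))]opprD [LHS]addrACA subrr add0r opprD !opprK [b * _ + _]addrC.
rewrite add_self.
have h0 : (0 : R) <= 2^-1 by rewrite invr_ge0.
move=> /(posZ h0); rewrite scalerA -rmorphM mulVf ?pnatr_eq0 //.
by rewrite scale1r.
Qed.

Lemma damp_comm h m j :
  (1 - (2^-1)%:C *: h) ^+ m * h ^+ j = h ^+ j * (1 - (2^-1)%:C *: h) ^+ m.
Proof.
have : (1 - (2^-1)%:C *: 'X) ^+ m * 'X ^+ j =
  'X ^+ j * (1 - (2^-1)%:C *: 'X) ^+ m :> {poly R[i]} by rewrite mulrC.
by move/(congr1 (ev h)); rewrite !evE.
Qed.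

Section Contraction.
Variable h : A.
Hypothesis (sh : star h = h) (h1 : cnorm h <= 1).
Let q := 1 - (2^-1)%:C *: h.

Lemma star_q : star q = q.
Proof. by rewrite starB star1 starZr sh. Qed.

(* [q^(2n) (1 - q^2)] decreases in [n], hence stays below [1]. *)
Lemma pos_damped n :
  pos (1 + (4^-1)%:C *: (h ^+ 2 * q ^+ n.*2) - h * q ^+ n.*2).
Proof.
have -> : 1 + (4^-1)%:C *: (h ^+ 2 * q ^+ n.*2) - h * q ^+ n.*2 =
    1 - q ^+ n.*2 * (1 - q ^+ 2).
  have : 1 + (4^-1)%:C *: ('X ^+ 2 * (1 - (2^-1)%:C *: 'X) ^+ n.*2)
       - 'X * (1 - (2^-1)%:C *: 'X) ^+ n.*2 =
      1 - (1 - (2^-1)%:C *: 'X) ^+ n.*2 * (1 - (1 - (2^-1)%:C *: 'X) ^+ 2) :> {poly R[i]}.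
    rewrite -!mul_polyC; set H := (2^-1)%:C%:P.
    have EH : H *+ 2 = 1.
      rewrite -polyCMn -(rmorphMn (real_complex R)).
      have -> : 2^-1 *+ 2 = 1 :> R by lra.
      by rewrite (rmorph1 (real_complex R)).
    have EQ : (4^-1)%:C%:P = H ^+ 2.
      by rewrite -polyC_exp -(rmorphXn (real_complex R)) exprVn -natrX.
    rewrite EQ; move: (_ ^+ n.*2) => Q.
    rewrite (_ : 1 - Q * _ = 1 + H ^+ 2 * ('X ^+ 2 * Q) - (H *+ 2) * ('X * Q)); last by ring.
    by rewrite EH mul1r.
  by move/(congr1 (ev h)); rewrite !evE.
have sq := star_q.
elim: n => [|n IH].
  by rewrite expr0 mul1r subKr; apply: pos_sq.
have -> : 1 - q ^+ n.+1.*2 * (1 - q ^+ 2) =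
    1 - q ^+ n.*2 * (1 - q ^+ 2) + (q ^+ n * (1 - q ^+ 2)) ^+ 2.
  have : 1 - 'X ^+ n.+1.*2 * (1 - 'X ^+ 2) =
    1 - 'X ^+ n.*2 * (1 - 'X ^+ 2) + ('X ^+ n * (1 - 'X ^+ 2)) ^+ 2 :> {poly R[i]}.
    rewrite doubleS -addnn -addn2 !exprD; ring.
  by move/(congr1 (ev q)); rewrite !evE.
apply: posD IH (pos_sq _).
rewrite star_mul starB star1 !starX sq.
have : (1 - 'X ^+ 2) * 'X ^+ n = 'X ^+ n * (1 - 'X ^+ 2) :> {poly R[i]} by rewrite mulrC.
by move/(congr1 (ev q)); rewrite !evE.
Qed.

(** In [pos_damped], the term [h^2 q^(2n) / 4] has norm at most [B / 4] because [cnorm h <= 1]. *)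
Lemma pos_damped_le n B : cnorm (h * q ^+ n.*2) <= B ->
  pos (sca (1 + B / 4) - h * q ^+ n.*2).
Proof.
move=> hB.
have sq := star_q.
have shq m : star (h ^+ m * q ^+ n.*2) = h ^+ m * q ^+ n.*2.
  by rewrite star_mul !starX sq sh damp_comm.
have -> : sca (1 + B / 4) - h * q ^+ n.*2 =
   (1 + (4^-1)%:C *: (h ^+ 2 * q ^+ n.*2) - h * q ^+ n.*2) +
   (sca (B / 4) - (4^-1)%:C *: (h ^+ 2 * q ^+ n.*2)).
  rewrite [RHS](AC ((2*1)*2) ((1*4)*3*(2*5))) /= subrr addr0.
  by rewrite scaD sca1.
apply: posD (pos_damped n) (pos_sca_sub _ _); first by rewrite starZr shq.
rewrite cnormZr ger0_norm ?invr_ge0 // mulrC ler_wpM2r ?invr_ge0 //.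
rewrite expr2 -mulrA (le_trans (cnorm_mul _ _)) // -[B]mul1r.
by rewrite ler_pM ?cnorm_ge0.
Qed.

(* [1 - q = h / 2], so the bound makes the powers of [q] grow at most linearly,
   which forces [cnorm q <= 1]. *)
Lemma pos_of_damped : (forall n, cnorm (h * q ^+ n.*2) <= 2) -> pos h.
Proof.
move=> H.
have q2 : cnorm q <= 2.
  rewrite (le_trans (cnormB _ _)) // cnormZr ger0_norm ?invr_ge0 //.
  have := @cnorm1_le R A; move: h1; lra.
have com m : q ^+ m * h = h * q ^+ m by exact: (damp_comm h m 1).
have hq m : cnorm (h * q ^+ m) <= 4.
  rewrite -(odd_double_half m); case: (odd m); rewrite ?add0n ?add1n; last first.
    by have := H m./2; lra.
  rewrite exprSr mulrA (le_trans (cnorm_mul _ _)) //.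
  have := H m./2; have := cnorm_ge0 q; have := cnorm_ge0 (h * q ^+ m./2.*2); nra.
have qm m : cnorm (q ^+ m) <= 2 * m.+1%:R.
  elim: m => [|m IH]; first by have := @cnorm1_le R A; rewrite expr0; lra.
  have -> : q ^+ m.+1 = q ^+ m - (2^-1)%:C *: (h * q ^+ m).
    by rewrite exprSr {2}/q mulrBr mulr1 scalerM com.
  rewrite (le_trans (cnormB _ _)) // cnormZr ger0_norm ?invr_ge0 //.
  have := hq m; rewrite -(natr1 m.+1); lra.
have q1 : cnorm q <= 1.
  apply: (@exp_le_linear_exp _ _ _ 2); rewrite ?cnorm_ge0 // => n.
  rewrite expr1n mulr1; case: n => [|n]; first by rewrite expr0; lra.
  exact: le_trans (cnormX_ge _ star_q) (qm _).
split=> // d d0; exists 2 => //.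
have -> : sca 2 - h = (2 : R)%:C *: q.
  rewrite scalerBr scalerA -rmorphM mulfV ?pnatr_eq0 // scale1r.
  by rewrite -sca_mul mulr1.
rewrite cnormZr ger0_norm //; lra.
Qed.

End Contraction.

(* For [b = a q^n], both [b^* b] and [b b^*] are at most [1 + B / 4], where [B] is
   their common norm, and their sum is positive; hence [B <= 1 + B / 4]. *)
Lemma pos_star_mul_contraction a : cnorm a <= 1 -> pos (star a * a).
Proof.
move=> a1; pose h := star a * a; pose k := a * star a.
have sh : star h = h by rewrite star_mul starK.
have sk : star k = k by rewrite star_mul starK.
have h1 : cnorm h <= 1.
  by rewrite cnorm_starM -[leRHS](expr1n _ 2) ler_pXn2r ?nnegrE ?cnorm_ge0.
have k1 : cnorm k <= 1.
  rewrite /k -{1}(starK a) cnorm_starM cnorm_star.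
  by rewrite -[leRHS](expr1n _ 2) ler_pXn2r ?nnegrE ?cnorm_ge0.
apply: pos_of_damped => // n; rewrite -/h.
set q := 1 - _ *: h; pose q' := 1 - (2^-1)%:C *: k.
have sq : star q = q by exact: star_q.
(* [a] intertwines [a^* a] with [a a^*], hence also [q] with [q']. *)
have comq m : a * q ^+ m = q' ^+ m * a.
  elim: m => [|m IH]; first by rewrite !expr0 mulr1 mul1r.
  rewrite exprSr mulrA IH exprSr -!mulrA; congr (_ * _).
  by rewrite mulrBr mulrBl mulr1 mul1r scalelM scalerM /h /k mulrA.
have comh m : h * q ^+ m = q ^+ m * h by exact: esym (damp_comm h m 1).
have comk m : k * q' ^+ m = q' ^+ m * k by exact: esym (damp_comm k m 1).
pose b := a * q ^+ n.
have F : star b * b = h * q ^+ n.*2.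
  by rewrite star_mul starX sq mulrA -[_ * a]mulrA -comh -mulrA -exprD addnn.
have F' : b * star b = k * q' ^+ n.*2.
  rewrite star_mul starX sq mulrA -[_ * q ^+ n]mulrA -exprD addnn comq comk.
  by rewrite -mulrA.
have nF : cnorm (k * q' ^+ n.*2) = cnorm (h * q ^+ n.*2).
  by rewrite -F -F' -{1}(starK b) !cnorm_starM cnorm_star.
have := pos_damped_le sh h1 (lexx (cnorm (h * q ^+ n.*2))); rewrite -/q => p1.
have := pos_damped_le sk k1 (lexx (cnorm (k * q' ^+ n.*2))); rewrite -/q' nF => p2.
(* Adding [b b^* <= 1 + B / 4] to [0 <= b^* b + b b^*] bounds [b^* b] below by [- (1 + B / 4)]. The
   final [B <= 1 + B / 4] gives [B <= 4 / 3]. *)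
have := posD (pos_star_add b) p2; rewrite F F'.
rewrite [_ + _ + (_ - _)](AC (2*2) ((3*1)*(2*4))) /= subrr addr0 => p3.
have := cnorm_le_pos _ _ p1 p3; have := cnorm_ge0 (h * q ^+ n.*2).
rewrite -{2}F star_mul starK F => c0 /(_ erefl); lra.
Qed.

Lemma pos_star_mul a : pos (star a * a).
Proof.
have [->|a0] := eqVneq a 0.
  by rewrite star0 -expr2; apply: pos_sq; exact: star0.
have n0 : 0 < cnorm a by rewrite cnorm_gt0.
have := @pos_star_mul_contraction ((cnorm a)^-1%:C *: a).
rewrite cnormZr ger0_norm ?invr_ge0 ?cnorm_ge0 // mulVf ?gt_eqF // => /(_ (lexx _)).
move=> /(posZ (exprn_ge0 2 (ltW n0))).
rewrite starZr scalelM scalerM !scalerA -!rmorphM expr2 /=.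
by rewrite -[_ / _ / _]mulrA -invfM mulfV ?mulf_neq0 ?gt_eqF // scale1r.
Qed.

End StarSquares.

(** * Limits in the algebra and an abstract Cauchy-Schwarz inequality *)

Section Convergence.
Context {R : realType} {A : unitalCStarType R}.
Implicit Types (a b c h k : A) (u v : nat -> A) (s t B d e : R).

Lemma cnorm_lt_norm a e : (cnorm a < e) = (`|a| < e%:C).
Proof. by rewrite norm_cnorm ltcR. Qed.

Lemma pos_complex (e : R[i]) : 0 < e -> exists2 r : R, 0 < r & e = r%:C.
Proof.
case: e => p q; rewrite ltcE /= => /andP[/eqP q0 p0].
by exists p => //; rewrite q0.
Qed.

Lemma cvgA u (l : A) : u @ \oo --> l <->
  forall e, 0 < e -> exists N, forall n, (N <= n)%N -> cnorm (l - u n) < e.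
Proof.
split=> [ul e e0|H].
  have ec0 : 0 < e%:C by rewrite ltcR.
  have /cvgrPdist_lt/(_ _ ec0) := ul.
  move=> [N _ HN]; exists N => n Nn; rewrite cnorm_lt_norm; exact: HN.
apply/cvgrPdist_lt => e /pos_complex[r r0 ->].
have [N HN] := H _ r0; exists N => // n Nn.
by rewrite /= -cnorm_lt_norm; apply: HN.
Qed.

Definition cauchyA u := forall e, 0 < e ->
  exists N, forall m n, (N <= m <= n)%N -> cnorm (u n - u m) < e.

Lemma cauchyA_cvg u : cauchyA u -> cvgn u.
Proof.
move=> H; apply: cauchy_cvg; apply/cauchy_exP => e /pos_complex[r r0 ->].
have [N HN] := H _ r0; exists (u N); exists N => // n Nn /=.
by rewrite -ball_normE /ball_ /= distrC -cnorm_lt_norm; apply: HN; rewrite leqnn.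
Qed.

Lemma cvg_cauchyA u : cvgn u -> cauchyA u.
Proof.
move=> /cvgA H e e0; have e2 : 0 < e / 2 by lra.
have [N HN] := H _ e2; exists N => m n /andP[Nm mn].
have := HN n (leq_trans Nm mn); have := HN m Nm.
have := cnormB (limn u - u m) (limn u - u n).
rewrite opprB [_ + (u n - _)]addrC addrA subrK; lra.
Qed.

Lemma cvgA_unique u (l l' : A) : u @ \oo --> l -> u @ \oo --> l' -> l = l'.
Proof. by apply: cvg_unique; exact: norm_hausdorff. Qed.

Lemma cvgA_mulr u (l a : A) : u @ \oo --> l -> (fun n => u n * a) @ \oo --> l * a.
Proof.
move=> /cvgA H; apply/cvgA => e e0.
have a1 : 0 < cnorm a + 1 by have := cnorm_ge0 a; lra.
have [N HN] := H _ (divr_gt0 e0 a1); exists N => n /HN.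
rewrite ltr_pdivlMr // -mulrBl => h.
have := cnorm_mul (l - u n) a; have := cnorm_ge0 (l - u n); nra.
Qed.

Lemma cvgA_star u (l : A) : u @ \oo --> l -> (fun n => star (u n)) @ \oo --> star l.
Proof.
move=> /cvgA H; apply/cvgA => e /H[N HN]; exists N => n /HN.
by rewrite -starB cnorm_star.
Qed.

Lemma cvgA_le u (l : A) B : u @ \oo --> l -> (forall n, cnorm (u n) <= B) -> cnorm l <= B.
Proof.
move=> /cvgA H HB; apply/ler_addgt0Pr => e /H[N HN].
have := HN N (leqnn _); have := HB N; have := cnorm_lerB l (u N); lra.
Qed.

Lemma cvgA_pos u (l : A) : u @ \oo --> l -> (forall n, pos (u n)) -> pos l.
Proof.
move=> ul H; apply: pos_closed.
  have sl := cvgA_star ul; apply: cvgA_unique sl _.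
  by under eq_cvg do rewrite (H _).1.
move=> d d0; have /cvgA/(_ _ d0)[N HN] := ul.
by exists (u N) => //; rewrite ltW // HN.
Qed.

Lemma cvgA_cnorm u (l : A) : u @ \oo --> l ->
  forall e, 0 < e -> exists N, forall n, (N <= n)%N -> `|cnorm l - cnorm (u n)| < e.
Proof.
move=> /cvgA H e /H[N HN]; exists N => n /HN.
have := cnorm_lerB l (u n); have := cnorm_lerB (u n) l; rewrite cdistC.
by rewrite ltr_norml; lra.
Qed.

Lemma pos0 : pos (0 : A).
Proof. by rewrite -(mulr0 (star 0)); exact: pos_star_mul. Qed.

(* Optimizing [2 l s^* s <= l^2 s^* p s + q] over [l]. *)
Lemma cauchy_schwarz_pos p q (s : A) :
  (forall l : R, 0 <= l ->
     pos ((l ^+ 2)%:C *: (star s * p * s) - (2 * l)%:C *: (star s * s) + q)) ->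
  cnorm s ^+ 2 <= cnorm p * cnorm q.
Proof.
move=> H.
have H2 (l : R) : 0 <= l -> 2 * l * cnorm s ^+ 2 <= l ^+ 2 * (cnorm p * cnorm s ^+ 2) + cnorm q.
  move=> l0; have l2 : 0 <= 2 * l by lra.
  have := cnorm_pos_mono (posZ l2 (pos_star_mul s)) (H l l0).
  rewrite [_ - _ + q]addrAC [_ + (_ - _)]addrC subrK.
  rewrite cnormZr ger0_norm // cnorm_starM => /le_trans; apply.
  rewrite (le_trans (cnormD _ _)) // lerD2r cnormZr ger0_norm ?sqr_ge0 //.
  rewrite ler_wpM2l ?sqr_ge0 // (le_trans (cnorm_mul _ _)) //.
  have := cnorm_mul (star s) p; rewrite cnorm_star.
  have := cnorm_ge0 s; have := cnorm_ge0 p; nra.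
move: H2; set S := cnorm s ^+ 2; set P := cnorm p; set Q := cnorm q => H2.
have S0 : 0 <= S by rewrite exprn_ge0 // cnorm_ge0.
have P0 : 0 <= P by exact: cnorm_ge0.
have Q0 : 0 <= Q by exact: cnorm_ge0.
have [Pe|Pn] := eqVneq P 0.
  rewrite Pe mul0r; rewrite leNgt; apply/negP => Sp.
  (* For [P = 0] the bound is [2 l S <= Q] for every [l >= 0], which this [l] violates. *)
  have l0 : 0 <= (Q + 1) / S by rewrite divr_ge0 //; lra.
  have := H2 _ l0; rewrite Pe mul0r mulr0 add0r -mulrA mulfVK ?gt_eqF //; lra.
have Pp : 0 < P by rewrite lt_def Pn.
(* The value [l = 1 / P] is optimal. *)
have := H2 P^-1; rewrite invr_ge0 => /(_ P0).
rewrite -(ler_pM2l Pp) mulrDr.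
have -> : P * (2 / P * S) = 2 * S by field.
have -> : P * (P^-1 ^+ 2 * (P * S)) = S by field.
lra.
Qed.
End Convergence.

(** * The standard Hilbert module *)

Section SequenceModule.
Context {R : realType} {A : unitalCStarType R}.
Implicit Types (a b : A) (x y z : nat -> A) (s t B d e : R) (m n : nat).

Definition seg m n x y : A := \sum_(m <= i < n) star (x i) * y i.

Definition rmul x a : nat -> A := fun i => x i * a.

Lemma segDr m n x y z : seg m n x (y + z) = seg m n x y + seg m n x z.
Proof. by rewrite -big_split; apply: eq_bigr => i _; rewrite mulrDr. Qed.

Lemma segDl m n x y z : seg m n (x + y) z = seg m n x z + seg m n y z.
Proof. rewrite -big_split; apply: eq_bigr => i _.
by rewrite -[(x + y) i]/(x i + y i) starD mulrDl. Qed.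

Lemma segNr m n x y : seg m n x (- y) = - seg m n x y.
Proof. by rewrite -sumrN; apply: eq_bigr => i _; rewrite -mulrN. Qed.

Lemma segNl m n x y : seg m n (- x) y = - seg m n x y.
Proof. by rewrite -sumrN; apply: eq_bigr => i _; rewrite -mulNr -starN. Qed.

Lemma segMr m n x y a : seg m n x (rmul y a) = seg m n x y * a.
Proof. by rewrite mulr_suml; apply: eq_bigr => i _; rewrite mulrA. Qed.

Lemma seg_star m n x y : star (seg m n x y) = seg m n y x.
Proof.
rewrite /seg; elim/big_rec2: _ => [|i p q _ <-]; first exact: star0.
by rewrite starD star_mul starK.
Qed.

Lemma segMl m n x y a : seg m n (rmul x a) y = star a * seg m n x y.
Proof. by rewrite -seg_star segMr star_mul seg_star. Qed.

Lemma seg_pos m n x : pos (seg m n x x).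
Proof.
rewrite /seg; elim/big_rec: _ => [|i p _]; first exact: pos0.
by apply: posD; exact: pos_star_mul.
Qed.

(* Expands [<x r - y, x r - y>] for [r = l <x, y>]. *)
Lemma seg_cauchy_schwarz m n x y :
  cnorm (seg m n x y) ^+ 2 <= cnorm (seg m n x x) * cnorm (seg m n y y).
Proof.
apply: cauchy_schwarz_pos => l l0.
set s := seg m n x y.
have := seg_pos m n (rmul x (l%:C *: s) - y).
rewrite !(segDl, segDr, segNl, segNr, segMl, segMr) -(seg_star m n x y) -/s.
rewrite starZr !scalelM !scalerM !scalerA -rmorphM -expr2 opprK mulrA.
by rewrite addrA -[_ - _ - _]addrA -opprD -scalerDl -rmorphD -mulr2n -(mulr_natl l 2).
Qed.

(** The parallelogram law with the positive term [<x - y, x - y>] dropped; it takes the place of a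
    triangle inequality on segments. *)
Lemma seg_parallelogram m n x y :
  cnorm (seg m n (x + y) (x + y)) <= 2 * (cnorm (seg m n x x) + cnorm (seg m n y y)).
Proof.
have := cnorm_pos_mono (seg_pos m n (x + y)) (seg_pos m n (x - y)).
have -> : seg m n (x + y) (x + y) + seg m n (x - y) (x - y) =
    (2 : R)%:C *: (seg m n x x + seg m n y y).
  rewrite !(segDl, segDr, segNl, segNr) opprK -add_self.
  rewrite [LHS](AC ((2*2)*(2*2)) (((1*4)*(5*8))*((2*6)*(3*7)))) /= !subrr !addr0.
  by [].
move=> /le_trans; apply; rewrite cnormZr ger0_norm // ler_wpM2l //.
exact: cnormD.
Qed.

Lemma seg_cat m n p x y : (m <= n)%N -> (n <= p)%N ->
  seg m p x y = seg m n x y + seg n p x y.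
Proof. by move=> mn np; rewrite /seg (big_cat_nat mn np). Qed.

Lemma psumE x y n : \sum_(i < n) star (x i) ** y i = seg 0 n x y.
Proof. by rewrite /seg big_mkord. Qed.

Lemma psum_cauchy x y : cauchyA (fun n => \sum_(i < n) star (x i) ** y i) <->
  forall e, 0 < e -> exists N, forall m n, (N <= m <= n)%N -> cnorm (seg m n x y) < e.
Proof.
have E m n : (m <= n)%N -> (\sum_(i < n) star (x i) ** y i)
    - (\sum_(i < m) star (x i) ** y i) = seg m n x y.
  move=> mn; rewrite !psumE (seg_cat _ _ (leq0n m) mn).
  by rewrite [seg 0 m _ _ + _]addrC addrK.
by split=> H e /H[N HN]; exists N => m n /[dup]/HN + /andP[_ mn]; rewrite E.
Qed.

Lemma l2P x : l2 x <->
  forall e, 0 < e -> exists N, forall m n, (N <= m <= n)%N -> cnorm (seg m n x x) < e.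
Proof.
rewrite -psum_cauchy; split; [exact: cvg_cauchyA|exact: cauchyA_cvg].
Qed.

Lemma psum_cvg x y : l2 x -> l2 y ->
  (fun n => \sum_(i < n) star (x i) ** y i) @ \oo --> inner x y.
Proof.
move=> /l2P lx /l2P ly.
suff : cvgn (fun n => \sum_(i < n) star (x i) ** y i) by [].
apply: cauchyA_cvg; apply/psum_cauchy => e e0.
have [N HN] := lx e e0; have [N' HN'] := ly e e0.
exists (N + N')%N => m n /andP[h mn].
have h1 := HN m n _; have h2 := HN' m n _.
have : cnorm (seg m n x y) ^+ 2 < e ^+ 2.
  apply: le_lt_trans (seg_cauchy_schwarz m n x y) _.
  rewrite expr2 ltr_pM ?cnorm_ge0 //; [apply: h1|apply: h2]; lia.
by rewrite ltr_pXn2r ?nnegrE ?cnorm_ge0 ?ltW.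
Qed.

Lemma inner_cvg x y : l2 x -> l2 y -> (fun n => seg 0 n x y) @ \oo --> inner x y.
Proof.
by move=> lx ly; have := psum_cvg lx ly; under eq_cvg do rewrite psumE.
Qed.

Lemma l2D x y : l2 x -> l2 y -> l2 (x + y).
Proof.
move=> /l2P lx /l2P ly; apply/l2P => e e0; have e4 : 0 < e / 4 by lra.
have [N HN] := lx _ e4; have [N' HN'] := ly _ e4.
exists (N + N')%N => m n h.
have /HN h1 : (N <= m <= n)%N by lia.
have /HN' h2 : (N' <= m <= n)%N by lia.
have := seg_parallelogram m n x y; lra.
Qed.

Lemma l2N x : l2 x -> l2 (- x).
Proof.
move=> /l2P lx; apply/l2P => e /lx[N HN]; exists N => m n.
by rewrite segNl segNr opprK; exact: HN.
Qed.

Lemma l2B x y : l2 x -> l2 y -> l2 (x - y).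
Proof. by move=> lx ly; apply: l2D lx (l2N ly). Qed.

Lemma l2_0 : l2 (0 : nat -> A).
Proof.
apply/l2P => e e0; exists 0 => m n _.
by rewrite /seg big1 ?cnorm0 // => i _; rewrite mulr0.
Qed.

Lemma inner_star x y : l2 x -> l2 y -> star (inner x y) = inner y x.
Proof.
move=> lx ly; have := cvgA_star (inner_cvg lx ly).
under eq_cvg do rewrite seg_star.
by move/cvgA_unique; apply; exact: inner_cvg.
Qed.

Lemma innerDr x y z : l2 x -> l2 y -> l2 z -> inner x (y + z) = inner x y + inner x z.
Proof.
move=> lx ly lz; apply: cvgA_unique (inner_cvg lx (l2D ly lz)) _.
under eq_cvg do rewrite segDr.
exact: cvgD (inner_cvg lx ly) (inner_cvg lx lz).
Qed.

Lemma innerNr x y : l2 x -> l2 y -> inner x (- y) = - inner x y.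
Proof.
move=> lx ly; apply: cvgA_unique (inner_cvg lx (l2N ly)) _.
under eq_cvg do rewrite segNr; exact: cvgN (inner_cvg lx ly).
Qed.

Lemma innerBr x y z : l2 x -> l2 y -> l2 z -> inner x (y - z) = inner x y - inner x z.
Proof. by move=> lx ly lz; rewrite innerDr ?innerNr //; exact: l2N. Qed.

Lemma innerDl x y z : l2 x -> l2 y -> l2 z -> inner (x + y) z = inner x z + inner y z.
Proof.
move=> lx ly lz; rewrite -inner_star ?innerDr ?starD ?inner_star //; exact: l2D.
Qed.

Lemma innerBl x y z : l2 x -> l2 y -> l2 z -> inner (x - y) z = inner x z - inner y z.
Proof.
move=> lx ly lz; rewrite -inner_star ?innerBr ?starB ?inner_star //; exact: l2B.
Qed.

Lemma inner_pos x : l2 x -> pos (inner x x).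
Proof. by move=> lx; apply: cvgA_pos (inner_cvg lx lx) _ => n; exact: seg_pos. Qed.

Definition sqn x : R := cnorm (inner x x).

Lemma sqn_ge0 x : 0 <= sqn x.
Proof. exact: cnorm_ge0. Qed.

Lemma l2norm_sq x : l2norm x ^+ 2 = sqn x.
Proof. by rewrite sqr_sqrtr ?sqn_ge0. Qed.

Lemma l2norm_lt x e : 0 < e -> (l2norm x < e) = (sqn x < e ^+ 2).
Proof.
by move=> e0; rewrite -l2norm_sq ltr_pXn2r // nnegrE ?sqrtr_ge0 ?ltW.
Qed.

Lemma l2norm_le1 x : (l2norm x <= 1) = (sqn x <= 1).
Proof.
by rewrite -[LHS](@ler_pXn2r _ 2) ?nnegrE ?sqrtr_ge0 // expr1n l2norm_sq.
Qed.

Lemma seg_le_sqn m n x : l2 x -> (m <= n)%N -> cnorm (seg m n x x) <= sqn x.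
Proof.
move=> lx mn; apply/ler_addgt0Pr => e e0.
have [N HN] := cvgA_cnorm (inner_cvg lx lx) e0.
(* The initial segment up to [N + n] contains the segment from [m] to [n], and its norm is within
   [e] of [sqn x]. *)
have := HN (N + n)%N (leq_addr _ _); rewrite ltr_norml => /andP[h _].
have := cnorm_pos_mono (seg_pos m n x) (posD (seg_pos 0 m x) (seg_pos n (N + n) x)).
have mNn := leq_trans mn (leq_addl N n).
rewrite addrCA -(seg_cat x x mn (leq_addl N n)) -(seg_cat x x (leq0n m) mNn).
rewrite /sqn; lra.
Qed.

Lemma sqn_le x B : l2 x -> (forall n, cnorm (seg 0 n x x) <= B) -> sqn x <= B.
Proof. by move=> lx; apply: cvgA_le; exact: inner_cvg. Qed.

Lemma inner_cauchy_schwarz x y : l2 x -> l2 y ->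
  cnorm (inner x y) ^+ 2 <= sqn x * sqn y.
Proof.
move=> lx ly.
have B0 : 0 <= sqn x * sqn y by rewrite mulr_ge0 ?sqn_ge0.
rewrite -(sqr_sqrtr B0) ler_pXn2r ?nnegrE ?cnorm_ge0 ?sqrtr_ge0 //.
apply: cvgA_le (inner_cvg lx ly) _ => n.
rewrite -(ger0_norm (cnorm_ge0 _)) -sqrtr_sqr ler_wsqrtr //.
rewrite (le_trans (seg_cauchy_schwarz _ _ _ _)) //.
by rewrite ler_pM ?cnorm_ge0 // seg_le_sqn.
Qed.

Lemma sqnN x : sqn (- x) = sqn x.
Proof.
congr (cnorm (lim _)); congr (_ @ \oo); apply/funext => n.
by rewrite !psumE segNl segNr opprK.
Qed.

Lemma sqnD x y : l2 x -> l2 y -> sqn (x + y) <= 2 * (sqn x + sqn y).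
Proof.
move=> lx ly; apply: sqn_le => [|n]; first exact: l2D.
rewrite (le_trans (seg_parallelogram _ _ _ _)) // ler_wpM2l // lerD //;
exact: seg_le_sqn.
Qed.

Lemma sqnB x y : l2 x -> l2 y -> sqn (x - y) <= 2 * (sqn x + sqn y).
Proof. by move=> lx ly; rewrite -(sqnN y); apply: sqnD => //; exact: l2N. Qed.

Lemma sqn0 : sqn 0 = 0.
Proof.
apply/eqP; rewrite eq_le sqn_ge0 andbT; apply: sqn_le => [|n]; first exact: l2_0.
by rewrite /seg big1 ?cnorm0 // => i _; rewrite mulr0.
Qed.

Lemma coord_le_sqn x i : l2 x -> cnorm (x i) ^+ 2 <= sqn x.
Proof.
move=> lx; have := @seg_le_sqn i i.+1 x lx (leqnSn _).
by rewrite /seg big_nat1 cnorm_starM.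
Qed.

Lemma sqn_eq0 x : l2 x -> sqn x = 0 -> x = 0.
Proof.
move=> lx x0; apply/funext => i; apply/eqP; rewrite -cnorm_eq0.
have := coord_le_sqn i lx; rewrite x0 => h.
by rewrite -sqrf_eq0 eq_le h sqr_ge0.
Qed.

Lemma pythagoras x y : l2 x -> l2 y -> inner x y = 0 ->
  inner (x + y) (x + y) = inner x x + inner y y.
Proof.
move=> lx ly xy0; have lxy := l2D lx ly.
have yx0 : inner y x = 0 by rewrite -inner_star // xy0 star0.
by rewrite innerDr // !innerDl // xy0 yx0 addr0 add0r.
Qed.

(** The limit [z] is taken coordinatewise. Convergence holds on each finite segment, then uniformly
    over segments, which gives both [l2 z] and convergence in norm. *)
Lemma l2_complete (y : nat -> nat -> A) :
  (forall n, l2 (y n)) ->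
  (forall e, 0 < e -> exists N, forall m n, (N <= m)%N -> (N <= n)%N ->
     sqn (y n - y m) < e) ->
  exists2 z, l2 z & forall e, 0 < e -> exists N, forall n, (N <= n)%N ->
     sqn (y n - z) < e.
Proof.
move=> ly yC.
have cvg_coord i : cvgn (fun n => y n i).
  apply: cauchyA_cvg => e e0; have [N HN] := yC _ (exprn_gt0 2 e0).
  exists N => m n /andP[Nm mn].
  have := HN m n Nm (leq_trans Nm mn).
  move/(le_lt_trans (coord_le_sqn i (l2B (ly n) (ly m)))).
  by rewrite ltr_pXn2r ?nnegrE ?cnorm_ge0 ?ltW.
pose z i := limn (fun n => y n i).
have seg_small k l e : 0 < e -> exists M, forall m, (M <= m)%N ->
    cnorm (seg k l (y m - z) (y m - z)) < e.
  elim: l e => [|l IH] e e0.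
    by exists 0 => m _; rewrite /seg big_geq // cnorm0.
  have [kl|lk] := leqP k l; last by exists 0 => m _; rewrite /seg big_geq ?cnorm0.
  have e2 : 0 < e / 2 by lra.
  have [M HM] := IH _ e2.
  have se : 0 < Num.sqrt (e / 2) by rewrite sqrtr_gt0.
  have /cvgA/(_ _ se)[M' HM'] : (fun n => y n l) @ \oo --> z l by exact: cvg_coord.
  exists (M + M')%N => m h.
  have /HM h1 : (M <= m)%N by lia.
  have /HM' h2 : (M' <= m)%N by lia.
  rewrite /seg big_nat_recr //= (le_lt_trans (cnormD _ _)) //.
  rewrite -[ltRHS](_ : e / 2 + e / 2 = e); last lra.
  rewrite ltrD // cnorm_starM.
  rewrite -(sqr_sqrtr (ltW e2)) ltr_pXn2r ?nnegrE ?cnorm_ge0 ?sqrtr_ge0 //.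
  by rewrite cdistC.
(* [M] depends on the segment but the bound does not: [y (M + N)] is close to [z] on that segment,
   and close to [y n] on all of them. *)
have unif e : 0 < e -> exists N, forall n, (N <= n)%N ->
    forall k l, (k <= l)%N -> cnorm (seg k l (y n - z) (y n - z)) < e.
  move=> e0; have e4 : 0 < e / 4 by lra.
  have [N HN] := yC _ e4; exists N => n Nn k l kl.
  have [M HM] := seg_small k l _ e4.
  have h1 := HN (M + N)%N n (leq_addl _ _) Nn.
  have h2 := HM (M + N)%N (leq_addr _ _).
  have h3 := seg_le_sqn (l2B (ly n) (ly (M + N)%N)) kl.
  have := seg_parallelogram k l (y n - y (M + N)%N) (y (M + N)%N - z).
  rewrite subrKA; lra.
have lz : l2 z.
  apply/l2P => e e0; have e4 : 0 < e / 4 by lra.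
  have [N /(_ N (leqnn _)) HN] := unif _ e4.
  have /l2P/(_ _ e4)[M HM] := ly N.
  exists M => m n /[dup] /HM h1 /andP[_ /HN h2].
  have := seg_parallelogram m n (y N) (- (y N - z)).
  rewrite subKr segNl segNr opprK; lra.
exists z => // e e0; have e2 : 0 < e / 2 by lra.
have [N HN] := unif _ e2; exists N => n Nn.
rewrite (@le_lt_trans _ _ (e / 2)) //; last lra.
by apply: sqn_le => [|l]; [exact: l2B|rewrite ltW // HN].
Qed.

End SequenceModule.

(** * The norm on the module and geometric limits *)

Section NormAndSubmodules.
Context {R : realType} {A : unitalCStarType R}.
Implicit Types (a b : A) (x y z : nat -> A) (s t B d e : R) (m n : nat).
Implicit Types M N : set (nat -> A).

Lemma l2_rmul x a : l2 x -> l2 (rmul x a).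
Proof.
move=> /l2P lx; apply/l2P => e e0.
have a1 : 0 < cnorm a ^+ 2 + 1 by have := sqr_ge0 (cnorm a); lra.
have [K HK] := lx _ (divr_gt0 e0 a1); exists K => m n /HK.
rewrite segMr segMl ltr_pdivlMr // => h.
have h1 := cnorm_mul (star a * seg m n x x) a.
have h2 := cnorm_mul (star a) (seg m n x x); rewrite cnorm_star in h2.
have := cnorm_ge0 a; have := cnorm_ge0 (seg m n x x); nra.
Qed.

Lemma innerMr x y a : l2 x -> l2 y -> inner x (rmul y a) = inner x y * a.
Proof.
move=> lx ly; apply: cvgA_unique (inner_cvg lx (l2_rmul ly)) _.
under eq_cvg do rewrite segMr; exact: cvgA_mulr (inner_cvg lx ly).
Qed.

Lemma innerMl x y a : l2 x -> l2 y -> inner (rmul x a) y = star a * inner x y.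
Proof.
move=> lx ly; rewrite -inner_star ?innerMr ?star_mul ?inner_star //; exact: l2_rmul.
Qed.

(** Real scaling through the right action, under which submodules are stable. *)
Definition rscale t x := rmul x (sca t).

Lemma cnorm_inner_rscale s t x y : l2 x -> l2 y ->
  cnorm (inner (rscale s x) (rscale t y)) = `|s| * `|t| * cnorm (inner x y).
Proof.
move=> lx ly; rewrite innerMr ?innerMl //; last exact: l2_rmul.
by rewrite star_sca mul_sca sca_mul !cnormZr mulrCA mulrA.
Qed.

Lemma l2norm_ge0 x : 0 <= l2norm x.
Proof. exact: sqrtr_ge0. Qed.

Lemma l2norm_rscale t x : l2 x -> l2norm (rscale t x) = `|t| * l2norm x.
Proof.
move=> lx; rewrite /l2norm cnorm_inner_rscale // sqrtrM ?mulr_ge0 //.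
by rewrite -expr2 sqrtr_sqr normr_id.
Qed.

Lemma rscaleD t x y : rscale t (x + y) = rscale t x + rscale t y.
Proof. by apply/funext => i; rewrite /rscale /rmul -[(_ + _) i]/(x i + y i) mulrDl. Qed.

Lemma rscaleN t x : rscale t (- x) = - rscale t x.
Proof. by apply/funext => i; rewrite /rscale /rmul -[(- x) i]/(- x i) mulNr. Qed.

Lemma rscaleK t x : t != 0 -> rscale t (rscale t^-1 x) = x.
Proof.
move=> t0; apply/funext => i; rewrite /rscale /rmul -mulrA -scaM mulVf //.
by rewrite sca1 mulr1.
Qed.

Lemma l2norm0 : l2norm (0 : nat -> A) = 0.
Proof. by rewrite /l2norm -/(sqn 0) sqn0 sqrtr0. Qed.

Lemma l2norm_eq0 x : l2 x -> l2norm x = 0 -> x = 0.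
Proof. by move=> lx x0; apply: sqn_eq0 => //; rewrite -l2norm_sq x0 expr0n. Qed.

Lemma l2normN x : l2norm (- x) = l2norm x.
Proof. by rewrite /l2norm -/(sqn _) sqnN. Qed.

Lemma l2distC x y : l2norm (x - y) = l2norm (y - x).
Proof. by rewrite -l2normN opprB. Qed.

Lemma cnorm_inner_le x y : l2 x -> l2 y -> cnorm (inner x y) <= l2norm x * l2norm y.
Proof.
move=> lx ly; rewrite -(@ler_pXn2r _ 2) ?nnegrE ?mulr_ge0 ?cnorm_ge0 ?l2norm_ge0 //.
by rewrite exprMn !l2norm_sq inner_cauchy_schwarz.
Qed.

Lemma l2normD x y : l2 x -> l2 y -> l2norm (x + y) <= l2norm x + l2norm y.
Proof.
move=> lx ly; have lxy := l2D lx ly.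
rewrite -(@ler_pXn2r _ 2) ?nnegrE ?addr_ge0 ?l2norm_ge0 //.
rewrite l2norm_sq /sqn innerDr ?innerDl //.
have h1 := cnormD (inner x x + inner y x) (inner x y + inner y y).
have h2 := cnormD (inner x x) (inner y x).
have h3 := cnormD (inner x y) (inner y y).
have h4 := cnorm_inner_le lx ly; have h5 := cnorm_inner_le ly lx.
rewrite sqrrD !l2norm_sq /sqn mulr2n; lra.
Qed.

Lemma l2normB x y : l2 x -> l2 y -> l2norm (x - y) <= l2norm x + l2norm y.
Proof. by move=> lx ly; rewrite -(l2normN y); apply: l2normD => //; apply: l2N. Qed.

Lemma l2norm_split x y z : l2 x -> l2 y -> l2 z ->
  l2norm (x - z) <= l2norm (x - y) + l2norm (y - z).
Proof.
by move=> lx ly lz; rewrite -[x - z](subrKA y); apply: l2normD; exact: l2B.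
Qed.

Lemma halving_small (s : nat -> R) : (forall n, 0 <= s n) ->
  (forall n, s n.+1 <= s n / 2) -> forall e, 0 < e -> exists n, s n < e.
Proof.
move=> s0 sh.
have sgeo n : s n * 2 ^+ n <= s 0.
  elim: n => [|n IH]; first by rewrite expr0 mulr1.
  apply: le_trans IH; rewrite exprS mulrA ler_pM2r ?exprn_gt0 //.
  have := sh n; lra.
move=> e e0; exists (Num.bound (s 0 / e)).
set n := Num.bound _; have := sgeo n.
have : s 0 / e < 2 ^+ n.
  apply: lt_trans (archi_boundP _) _; first by rewrite divr_ge0 // ltW.
  by rewrite -natrX ltr_nat ltn_expl.
rewrite ltr_pdivrMr // => h1 h2.
have : s n * 2 ^+ n < e * 2 ^+ n by rewrite (le_lt_trans h2) // mulrC.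
by rewrite ltr_pM2r ?exprn_gt0.
Qed.

(** As [s n / 2 <= s n - s n.+1], the increments telescope and [u n] stays within [s n] of all later
    terms. *)
Lemma telescoping_limit (u : nat -> nat -> A) (s : nat -> R) :
  (forall n, l2 (u n)) -> (forall n, 0 <= s n) -> (forall n, s n.+1 <= s n / 2) ->
  (forall n, l2norm (u n.+1 - u n) <= s n / 2) ->
  exists2 z, l2 z & forall n, l2norm (u n - z) <= s n.
Proof.
move=> lu s0 sh su.
have dist n k : l2norm (u (k + n)%N - u n) <= s n - s (k + n)%N.
  elim: k => [|k IH]; first by rewrite add0n !subrr l2norm0.
  have := l2norm_split (lu (k.+1 + n)%N) (lu (k + n)%N) (lu n).
  have := su (k + n)%N; have := sh (k + n)%N; rewrite addSn; lra.
have [|z lz zlim] := l2_complete lu.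
  move=> e e0.
  have [n hn] : exists n, s n < Num.sqrt e / 2.
    by apply: halving_small; rewrite ?divr_gt0 ?sqrtr_gt0.
  exists n => i j ni nj.
  rewrite -(sqr_sqrtr (ltW e0)) -l2norm_lt ?sqrtr_gt0 //.
  have := l2norm_split (lu j) (lu n) (lu i); rewrite [l2norm (u n - u i)]l2distC.
  have := dist n (i - n)%N; have := dist n (j - n)%N; rewrite !subnK //.
  have := s0 i; have := s0 j; lra.
exists z => // n; apply/ler_addgt0Pr => e e0.
have [N HN] := zlim _ (exprn_gt0 2 e0).
have := HN (N + n)%N (leq_addr _ _); rewrite -l2norm_lt // => h.
have := l2norm_split (lu n) (lu (N + n)%N) lz.
have := dist n N; rewrite [l2norm (u (N + n)%N - u n)]l2distC.
have := s0 (N + n)%N; lra.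
Qed.

(** * Submodules and orthogonal projections *)

Section Submodule.
Variable M : set (nat -> A).
Hypothesis smM : submodule M.

Lemma submod_l2 x : M x -> l2 x.
Proof. by case: smM => H _ _ _ /H. Qed.

Lemma submod0 : M 0.
Proof. by case: smM. Qed.

Lemma submodD x y : M x -> M y -> M (x + y).
Proof. by case: smM => _ _ H _; exact: H. Qed.

Lemma submod_rscale t x : M x -> M (rscale t x).
Proof. by case: smM => _ _ _ H Mx; exact: H. Qed.

Lemma submodN x : M x -> M (- x).
Proof.
case: smM => _ _ _ H Mx; have := H x (- 1) Mx; congr M; apply/funext => i.
exact: mulrN1.
Qed.

Lemma submodB x y : M x -> M y -> M (x - y).
Proof. by move=> Mx My; apply: submodD Mx (submodN My). Qed.

Hypothesis ncM : norm_closed M.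

Lemma submod_lim (u : nat -> nat -> A) z : l2 z -> (forall n, M (u n)) ->
  (forall e, 0 < e -> exists n, l2norm (u n - z) < e) -> M z.
Proof.
move=> lz Mu H; apply: ncM => // e /H[n hn].
by exists (u n) => //; rewrite l2distC.
Qed.

Hypothesis ocM : orthogonally_complementable M.

(** The premise [l2 z] stands under the existential so that [proj] is a total function; its values
    outside [l2] carry no information. *)
Lemma projection_exists z : exists u, l2 z -> M u /\ orthogonal M (z - u).
Proof.
have [lz|nlz] := pselect (l2 z); last by exists 0.
have : sumset M (orthogonal M) z by rewrite ocM.1.
move=> [u Mu [v Ov <-]]; exists u => _; split=> //.
by rewrite addrAC subrr add0r.
Qed.

Definition proj z := sval (cid (projection_exists z)).

Lemma proj_mem z : l2 z -> M (proj z).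
Proof. by rewrite /proj; case: cid => u H /= /H[]. Qed.

Lemma proj_l2 z : l2 z -> l2 (proj z).
Proof. by move=> /proj_mem/submod_l2. Qed.

Lemma proj_orthogonal x z : l2 z -> M x -> inner x (z - proj z) = 0.
Proof. by rewrite /proj; case: cid => u H /= /H[_ [_ h]] /h. Qed.

Lemma inner_proj x z : l2 z -> M x -> inner x (proj z) = inner x z.
Proof.
move=> lz Mx; have lx := submod_l2 Mx; have lp := proj_l2 lz.
apply/esym/eqP; rewrite -subr_eq0 -innerBr //; apply/eqP.
exact: proj_orthogonal.
Qed.

(** [x + P z] lies in [M] and [z - P z] is orthogonal to [M]. The identity is [A]-valued, so that
    [cnorm_pos_mono] applies to it. *)
Lemma proj_pythagoras x z : l2 z -> M x ->
  inner (x + z) (x + z) =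
  inner (x + proj z) (x + proj z) + inner (z - proj z) (z - proj z).
Proof.
move=> lz Mx; have Mp := proj_mem lz; have lx := submod_l2 Mx.
have lp := proj_l2 lz; have lzp := l2B lz lp.
rewrite -[in LHS](subrK (proj z) z) [in LHS](addrC _ (proj z)) addrA.
exact: (pythagoras (l2D lx lp) lzp (proj_orthogonal lz (submodD Mx Mp))).
Qed.

End Submodule.

End NormAndSubmodules.

(** * Closed sums *)

Section OpenMapping.
Context {R : realType} {A : unitalCStarType R}.
Implicit Types (x y z : nat -> A) (s t e r K : R) (m n : nat).
Variables M N : set (nat -> A).
Hypotheses (clM : closed_submodule M) (clN : closed_submodule N).
Local Notation Z := (sumset M N).

Let smM : submodule M := clM.1.
Let smN : submodule N := clN.1.

Lemma sumset_mem x y : M x -> N y -> Z (x + y).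
Proof. by move=> Mx Ny; exists x => //; exists y. Qed.

Lemma sumset_l2 z : Z z -> l2 z.
Proof.
by move=> [x Mx [y Ny <-]]; apply: l2D; [exact: submod_l2 Mx|exact: submod_l2 Ny].
Qed.

Lemma sumsetD z w : Z z -> Z w -> Z (z + w).
Proof.
move=> [x Mx [y Ny <-]] [x' Mx' [y' Ny' <-]].
by rewrite addrACA; apply: sumset_mem; apply: submodD.
Qed.

Lemma sumset_rscale t z : Z z -> Z (rscale t z).
Proof.
by move=> [x Mx [y Ny <-]]; rewrite rscaleD; apply: sumset_mem; apply: submod_rscale.
Qed.

Lemma sumsetB z w : Z z -> Z w -> Z (z - w).
Proof.
move=> [x Mx [y Ny <-]] [x' Mx' [y' Ny' <-]].
by rewrite opprD addrACA; apply: sumset_mem; apply: submodB.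
Qed.

(** Only the [N]-component is bounded by [K], since the lower bound sought concerns [sqn y]. *)
Definition approx K z e := exists x y,
  [/\ M x, N y, l2norm y <= K & l2norm (z - (x + y)) < e].

Section Closed.
Hypothesis ncZ : norm_closed Z.

(* Baire's argument with nested balls, for the cover of [M + N] by the sets of
   sums [x + y] with [l2norm y <= n]. *)
Lemma somewhere_dense : exists K z0 r, [/\ 0 <= K, 0 < r, Z z0 &
  forall z, Z z -> l2norm (z - z0) < r -> forall e, 0 < e -> approx K z e].
Proof.
apply: contrapT => H.
(* A state is a centre and a radius. If the claim fails for [K = n], the current ball contains a
   smaller closed one that misses all [x + y] with [l2norm y <= n]. The pair [(0, 0)] is a default
   for invalid states. *)
have step (ns : nat * ((nat -> A) * R)) : exists s' : (nat -> A) * R,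
    Z ns.2.1 -> 0 < ns.2.2 -> [/\ Z s'.1, 0 < s'.2, s'.2 <= ns.2.2 / 2,
      l2norm (s'.1 - ns.2.1) <= ns.2.2 / 2 &
      forall x y, M x -> N y -> l2norm y <= ns.1%:R -> s'.2 < l2norm (s'.1 - (x + y))].
  case: ns => n [z r] /=.
  have [Zz|nZ] := pselect (Z z); last by exists (0, 0).
  have [r0|nr] := pselect (0 < r); last by exists (0, 0).
  apply: contrapT => nex; apply: H; exists n%:R, z, (r / 2).
  split=> //; first lra.
  move=> z' Zz' z'r e e0; apply: contrapT => napx; apply: nex.
  have m0 : 0 < Num.min e r by rewrite lt_min e0.
  have me : Num.min e r <= e by rewrite ge_min lexx.
  have mr : Num.min e r <= r by rewrite ge_min lexx orbT.
  exists (z', Num.min e r / 2) => _ _ /=; split=> //; [lra|lra|exact: ltW|].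
  move=> x y Mx Ny yn; rewrite ltNge; apply/negP => h.
  by apply: napx; exists x, y; split=> //; lra.
have [g Hg] := choice step.
pose s := nat_rect (fun=> (nat -> A) * R)%type (0, 1) (fun n p => g (n, p)).
have sS n : s n.+1 = g (n, s n) by [].
have Z0 : Z 0 by rewrite -[0]addr0; apply: sumset_mem; exact: submod0.
have inv n : Z (s n).1 /\ 0 < (s n).2.
  by elim: n => [//|n [h1 h2]]; rewrite sS; have [] := Hg (n, s n) h1 h2.
have prop n := Hg (n, s n) (inv n).1 (inv n).2.
have s0 n : 0 <= (s n).2 by rewrite ltW //; have [] := inv n.
have sh n : (s n.+1).2 <= (s n).2 / 2 by rewrite sS; have [] := prop n.
have [||||z lz zlim] := @telescoping_limit R A (fun n => (s n).1) (fun n => (s n).2).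
- by move=> n; apply: sumset_l2; have [] := inv n.
- exact: s0.
- exact: sh.
- by move=> n; rewrite sS; have [] := prop n.
have [x Mx [y Ny xy]] : Z z.
  apply: ncZ => // e /(halving_small s0 sh)[n hn].
  exists (s n).1; first by have [] := inv n.
  by rewrite l2distC (le_lt_trans (zlim n)).
(* The limit [x + y] lies in every ball, including the one chosen to miss it because
   [l2norm y <= n]. *)
have [_ _ _ _] := prop (Num.bound (l2norm y)).
move=> /(_ x y Mx Ny (ltW (archi_boundP (l2norm_ge0 y)))).
by rewrite -sS xy ltNge zlim.
Qed.

Lemma approxB K K' z w e e' : l2 z -> l2 w -> approx K z e -> approx K' w e' ->
  approx (K + K') (z - w) (e + e').
Proof.
move=> lz lw [x [y [Mx Ny yK h]]] [x' [y' [Mx' Ny' yK' h']]].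
have lx := submod_l2 smM Mx; have ly := submod_l2 smN Ny.
have lx' := submod_l2 smM Mx'; have ly' := submod_l2 smN Ny'.
exists (x - x'), (y - y'); split; [exact: submodB|exact: submodB| |].
  by rewrite (le_trans (l2normB ly ly')) // lerD.
rewrite (_ : _ - _ = (z - (x + y)) - (w - (x' + y'))).
  rewrite (le_lt_trans (l2normB _ _)) ?ltrD //; apply: l2B => //; exact: l2D.
by rewrite [x - x' + _]addrACA -(opprD x' y') subrACA.
Qed.

Lemma approx_rscale K z e t : 0 < t -> l2 z -> approx K z e ->
  approx (t * K) (rscale t z) (t * e).
Proof.
move=> t0 lz [x [y [Mx Ny yK h]]].
have lx := submod_l2 smM Mx; have ly := submod_l2 smN Ny.
exists (rscale t x), (rscale t y); split; [exact: submod_rscale|exact: submod_rscale| |].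
  by rewrite l2norm_rscale // gtr0_norm // ler_pM2l.
rewrite -rscaleD -rscaleN -rscaleD l2norm_rscale ?gtr0_norm ?ltr_pM2l //.
by apply: l2B => //; exact: l2D.
Qed.

(** Subtracting the centre [z0] moves the ball of [somewhere_dense] to the origin at the price of
    doubling [K]; scaling by [t] gives all radii. *)
Lemma dense_ball : exists K r, [/\ 0 <= K, 0 < r &
  forall t z, 0 < t -> Z z -> l2norm z < t * r -> forall e, 0 < e -> approx (t * K) z e].
Proof.
have [K [z0 [r [K0 r0 Z0 H]]]] := somewhere_dense.
exists (K + K), r; split=> //; first by rewrite addr_ge0.
move=> t z t0 Zz zr e e0.
have tn : t != 0 by rewrite gt_eqF.
have d0 : 0 < e / (2 * t) by rewrite divr_gt0 // mulr_gt0.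
have Zw := sumset_rscale t^-1 Zz; have lz := sumset_l2 Zz; have l0 := sumset_l2 Z0.
have lw := sumset_l2 Zw.
have a0 : approx K z0 (e / (2 * t)) by apply: H => //; rewrite subrr l2norm0.
have a1 : approx K (rscale t^-1 z + z0) (e / (2 * t)).
  apply: H => //; first exact: sumsetD.
  rewrite addrK l2norm_rscale // gtr0_norm ?invr_gt0 //.
  by rewrite mulrC ltr_pdivrMr // mulrC.
have := approx_rscale t0 _ (approxB (l2D lw l0) l0 a1 a0).
rewrite addrK rscaleK //.
have -> : t * (e / (2 * t) + e / (2 * t)) = e by field.
exact.
Qed.

(** Successive approximation: a remainder of norm below [2^(-n) r] is halved by removing a sum whose
    [N]-component has norm at most [2^(-n) K]. These components add up to norm at most [2 K]. *)
Lemma bounded_component : exists C r, [/\ 0 <= C, 0 < r &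
  forall z, Z z -> l2norm z < r -> exists y, [/\ N y, l2norm y <= C & M (z - y)]].
Proof.
have [K [r [K0 r0 H]]] := dense_ball.
exists (2 * K), r; split=> //; first by rewrite mulr_ge0.
move=> z Zz zr.
pose t n : R := 2^-1 ^+ n.
have t0 n : 0 < t n by rewrite exprn_gt0 // invr_gt0.
have tS n : t n.+1 = t n / 2 by rewrite /t exprSr.
have step (nz : nat * (nat -> A)) : exists p : (nat -> A) * (nat -> A),
    Z nz.2 -> l2norm nz.2 < t nz.1 * r ->
    [/\ Z p.1, l2norm p.1 < t nz.1.+1 * r, N p.2, l2norm p.2 <= t nz.1 * K &
        M (nz.2 - p.1 - p.2)].
  case: nz => n w /=.
  have [Zw|] := pselect (Z w); last by exists (0, 0).
  have [wr|] := pselect (l2norm w < t n * r); last by exists (0, 0).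
  have [x [y [Mx Ny yK h]]] := H _ _ (t0 n) Zw wr _ (mulr_gt0 (t0 n.+1) r0).
  exists (w - (x + y), y) => _ _ /=; split=> //.
    by apply: sumsetB => //; exact: sumset_mem.
  by rewrite subKr addrK.
have [g Hg] := choice step.
(* The state holds the remainder and the accumulated [N]-component. *)
pose s := nat_rect (fun=> (nat -> A) * (nat -> A))%type (z, 0)
  (fun n p => ((g (n, p.1)).1, p.2 + (g (n, p.1)).2)).
have s1 n : (s n.+1).1 = (g (n, (s n).1)).1 by [].
have s2 n : (s n.+1).2 = (s n).2 + (g (n, (s n).1)).2 by [].
have inv n : Z (s n).1 /\ l2norm (s n).1 < t n * r.
  elim: n => [|n [h1 h2]]; first by rewrite /= /t expr0 mul1r.
  by rewrite s1; have [] := Hg (n, (s n).1) h1 h2.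
have prop n := Hg (n, (s n).1) (inv n).1 (inv n).2.
have NY n : N (s n).2.
  elim: n => [|n IH]; first exact: submod0.
  by rewrite s2; apply: submodD => //; have [] := prop n.
have MX n : M (z - (s n).1 - (s n).2).
  elim: n => [|n IH]; first by rewrite /= subrr subr0; exact: submod0.
  have [_ _ _ _ h] := prop n.
  have := submodD smM IH h; congr M; rewrite s1 s2 /=.
  by rewrite [z - _ - _]addrAC -[_ - _ - (g _).2]addrA subrKA addrACA -opprD.
have lN y : N y -> l2 y by exact: submod_l2.
pose d n := 2 * K * t n.
have d0 n : 0 <= d n by rewrite !mulr_ge0 // ltW.
have dh n : d n.+1 <= d n / 2 by rewrite /d tS mulrA.
have [||||y ly ylim] := @telescoping_limit R A (fun n => (s n).2) d.
- by move=> n; exact: lN.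
- exact: d0.
- exact: dh.
- move=> n; rewrite s2 addrAC subrr add0r; have [_ _ _ h _] := prop n.
  rewrite (le_trans h) //= /d; lra.
exists y; split.
- apply: (submod_lim clN.2 ly NY) => e /(halving_small d0 dh)[n hn].
  by exists n; exact: le_lt_trans (ylim n) _.
- by have := ylim 0; rewrite /= sub0r l2normN /d /t expr0 mulr1.
- have lz := sumset_l2 Zz.
  apply: (submod_lim clM.2 (l2B lz ly) MX) => e e0.
  (* [2 K t n] bounds the missing tail of [y], and [r t n] the remainder. *)
  pose f n := (2 * K + r) * t n.
  have f0 n : 0 <= f n by rewrite mulr_ge0 ?addr_ge0 ?mulr_ge0 // ltW.
  have fh n : f n.+1 <= f n / 2 by rewrite /f tS mulrA.
  have [n hn] := halving_small f0 fh e0; exists n.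
  rewrite (_ : _ - _ = - (((s n).2 - y) + (s n).1)); last first.
    by rewrite -[z - _ - _]addrA -opprD subrACA subrr sub0r -addrA [_ + (_ - y)]addrC.
  rewrite l2normN (le_lt_trans (l2normD _ _)) //.
  + by apply: l2B => //; exact: lN.
  + by apply: sumset_l2; have [] := inv n.
  + have := ylim n; have [_ h] := inv n; move: hn; rewrite /f /d; lra.
Qed.

Hypothesis MN0 : M `&` N = [set 0].

(** Since [M] and [N] meet in 0, the bounded component of [x + y] is [y] itself; homogeneity does
    the rest. *)
Lemma closed_sum_lower_bound : exists2 k, 0 < k &
  forall x y, M x -> N y -> k * sqn y <= sqn (x + y).
Proof.
have disj x : M x -> N x -> x = 0.
  by move=> Mx Nx; have : (M `&` N) x by []; rewrite MN0.
have [C [r [C0 r0 H]]] := bounded_component.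
have H' x y : M x -> N y -> l2norm (x + y) < r -> l2norm y <= C.
  move=> Mx Ny /(H _ (sumset_mem Mx Ny))[y' [Ny' yC Mxy]].
  suff -> : y = y' by [].
  apply/eqP; rewrite -subr_eq0; apply/eqP; apply: disj; last exact: submodB.
  by have := submodB smM Mxy Mx; rewrite addrAC [x + y]addrC addrK.
(* Sums are rescaled to norm [r / 2 < r]; [C + 1] keeps [D] positive when [C = 0]. *)
pose D := (C + 1) / (r / 2).
have r2 : 0 < r / 2 by lra.
have D0 : 0 < D by rewrite divr_gt0 //; lra.
have HD x y : M x -> N y -> l2norm y <= D * l2norm (x + y).
  move=> Mx Ny; have ly := submod_l2 smN Ny; have lx := submod_l2 smM Mx.
  have lxy := l2D lx ly; set p := l2norm (x + y).
  have [p0|pn] := eqVneq p 0.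
    have xy0 := l2norm_eq0 lxy p0.
    have yx : y = - x by apply/eqP; rewrite -addr_eq0 addrC xy0.
    have -> : y = 0 by apply: disj => //; rewrite yx; exact: submodN.
    by rewrite l2norm0 p0 mulr0.
  have pp : 0 < p by rewrite lt_def pn l2norm_ge0.
  pose t := r / 2 / p.
  have tp : 0 < t by rewrite divr_gt0.
  have := H' (rscale t x) (rscale t y) (submod_rscale smM t Mx) (submod_rscale smN t Ny).
  rewrite -rscaleD !l2norm_rscale // gtr0_norm // -/p mulfVK //.
  have h : r / 2 < r by lra.
  move=> /(_ h) h2.
  have -> : D * p = (C + 1) / t by rewrite /D /t; field; rewrite pn gt_eqF.
  by rewrite ler_pdivlMr // mulrC; lra.
exists (D ^- 2); first by rewrite invr_gt0 exprn_gt0.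
move=> x y Mx Ny; rewrite mulrC ler_pdivrMr ?exprn_gt0 // mulrC -!l2norm_sq -exprMn.
have h := HD _ _ Mx Ny.
have D1 := mulr_ge0 (ltW D0) (l2norm_ge0 (x + y)).
by rewrite ler_pXn2r // nnegrE l2norm_ge0.
Qed.
End Closed.

(** If [x_n + y_n] tends to [z], the lower bound makes [y_n] Cauchy. Its limit [y] lies in [N], and
    [z - y], the limit of [x_n], lies in [M]. *)
Lemma sum_closed_of_lower_bound k : 0 < k ->
  (forall x y, M x -> N y -> k * sqn y <= sqn (x + y)) -> norm_closed Z.
Proof.
move=> k0 H z lz Hz.
have step (n : nat) : exists p : (nat -> A) * (nat -> A),
    [/\ M p.1, N p.2 & sqn (z - (p.1 + p.2)) < n.+1%:R^-1].
  have n0 : 0 < n.+1%:R^-1 :> R by rewrite invr_gt0.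
  have se : 0 < Num.sqrt n.+1%:R^-1 :> R by rewrite sqrtr_gt0.
  have [w [x Mx [y Ny <-]]] := Hz _ se.
  rewrite l2norm_lt ?sqrtr_gt0 // sqr_sqrtr ?ltW // => h.
  by exists (x, y).
have [p Hp] := choice step.
have small e : 0 < e -> exists K : nat, forall n, (K <= n)%N -> n.+1%:R^-1 < e.
  move=> e0; exists (Num.bound e^-1) => n hn.
  rewrite -[e]invrK ltf_pV2 ?posrE ?invr_gt0 //.
  apply: lt_trans (archi_boundP _) _; first by rewrite invr_ge0 ltW.
  by rewrite ltr_nat.
have lx n : l2 (p n).1 by apply: (submod_l2 smM); have [] := Hp n.
have ly n : l2 (p n).2 by apply: (submod_l2 smN); have [] := Hp n.
have [|y l2y ylim] := l2_complete ly.
  move=> e e0; have e1 : 0 < k * e / 4 by rewrite divr_gt0 // mulr_gt0.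
  have [K HK] := small _ e1; exists K => m n /HK hm /HK hn.
  have [Mm Nm sm] := Hp m; have [Mn Nn sn] := Hp n.
  have := H _ _ (submodB smM Mn Mm) (submodB smN Nn Nm).
  have -> : (p n).1 - (p m).1 + ((p n).2 - (p m).2) =
      (z - ((p m).1 + (p m).2)) - (z - ((p n).1 + (p n).2)).
    by rewrite [RHS]subrACA subrr sub0r opprB [LHS]addrACA -opprD.
  have := sqnB (l2B lz (l2D (lx m) (ly m))) (l2B lz (l2D (lx n) (ly n))).
  move=> h1 h2; rewrite -(ltr_pM2l k0).
  have := lt_trans sm hm; have := lt_trans sn hn; lra.
exists (z - y); last first.
  exists y; last by rewrite subrK.
  apply: clN.2 => // e e0; have [K HK] := ylim _ (exprn_gt0 2 e0).
  exists (p K).2; first by have [] := Hp K.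
  by rewrite l2distC l2norm_lt // HK.
apply: clM.2 => [|e e0]; first exact: l2B.
have e4 : 0 < e ^+ 2 / 4 by rewrite divr_gt0 // exprn_gt0.
have [K HK] := ylim _ e4; have [K' HK'] := small _ e4.
have /HK h1 := leq_addr K' K; have /HK' h2 := leq_addl K K'.
set n := (K + K')%N in h1 h2.
exists (p n).1; first by have [] := Hp n.
rewrite l2norm_lt //.
have -> : z - y - (p n).1 = (z - ((p n).1 + (p n).2)) + ((p n).2 - y).
  by rewrite opprD [z + (- _ - _)]addrA subrKA addrAC.
have [_ _ /lt_trans/(_ h2) h3] := Hp n.
have := sqnD (l2B lz (l2D (lx n) (ly n))) (l2B (ly n) l2y); lra.
Qed.

End OpenMapping.

(** * The Dixmier angle *)

Section DixmierAngle.
Context {R : realType} {A : unitalCStarType R}.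
Implicit Types (x y z : nat -> A) (s t e r K : R) (m n : nat).
Variables M N : set (nat -> A).
Hypotheses (clM : closed_submodule M) (clN : closed_submodule N).
Hypotheses (ocM : orthogonally_complementable M) (ocN : orthogonally_complementable N).

Let smM : submodule M := clM.1.
Let smN : submodule N := clN.1.
Local Notation cosines := [set r | exists x y, [/\ M x, N y, l2norm x <= 1,
  l2norm y <= 1 & r = cnorm (inner x y)]].

(** Together with the upper bound 1, this makes the [sup] in [c0] a true supremum. *)
Lemma cosines0 : cosines 0.
Proof.
exists 0, 0; split; [exact: submod0|exact: submod0| | |]; rewrite ?l2norm0 //.
have := cnorm_inner_le (@l2_0 R A) (@l2_0 R A); rewrite l2norm0 mulr0 => h.
by apply/eqP; rewrite eq_le h cnorm_ge0.
Qed.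

Lemma cosines_le1 r : cosines r -> r <= 1.
Proof.
move=> [x [y [Mx Ny x1 y1 ->]]].
have := cnorm_inner_le (submod_l2 smM Mx) (submod_l2 smN Ny).
by move/le_trans; apply; rewrite -[1]mulr1 ler_pM ?l2norm_ge0.
Qed.

Lemma c0_ge0 : 0 <= c0 M N.
Proof.
apply: ub_le_sup; last exact: cosines0.
by exists 1 => r; exact: cosines_le1.
Qed.

Lemma c0_bound x y : M x -> N y -> cnorm (inner x y) <= c0 M N * (l2norm x * l2norm y).
Proof.
move=> Mx Ny; have lx := submod_l2 smM Mx; have ly := submod_l2 smN Ny.
have := cnorm_inner_le lx ly.
have [x0|x0] := eqVneq (l2norm x) 0; first by rewrite x0 mul0r mulr0.
have [y0|y0] := eqVneq (l2norm y) 0; first by rewrite y0 !mulr0.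
move=> _; have xp : 0 < l2norm x by rewrite lt_def x0 l2norm_ge0.
have yp : 0 < l2norm y by rewrite lt_def y0 l2norm_ge0.
rewrite -ler_pdivrMr ?mulr_gt0 // mulrC.
apply: ub_le_sup; first by exists 1 => r; exact: cosines_le1.
exists (rscale (l2norm x)^-1 x), (rscale (l2norm y)^-1 y).
split; [exact: submod_rscale|exact: submod_rscale| | |].
- by rewrite l2norm_rscale // gtr0_norm ?invr_gt0 // mulVf.
- by rewrite l2norm_rscale // gtr0_norm ?invr_gt0 // mulVf.
- by rewrite cnorm_inner_rscale // !gtr0_norm ?invr_gt0 // invfM.
Qed.

Lemma c0_le r : (forall x y, M x -> N y -> l2norm x <= 1 -> l2norm y <= 1 ->
  cnorm (inner x y) <= r) -> c0 M N <= r.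
Proof.
move=> H; apply: ge_sup; first by exists 0; exact: cosines0.
by move=> _ [x [y [Mx Ny x1 y1 ->]]]; exact: H.
Qed.

(** Divide [|P y|^2 = |<P y, y>| <= c |P y| |y|] by [|P y|]. *)
Lemma sqn_proj_le y : N y -> sqn (proj ocM y) <= c0 M N ^+ 2 * sqn y.
Proof.
move=> Ny; have ly := submod_l2 smN Ny; have Mp := proj_mem ocM ly.
have lp := submod_l2 smM Mp.
have := c0_bound Mp Ny; rewrite -(inner_proj smM ocM ly Mp) -/(sqn _) -l2norm_sq.
have [->|p0] := eqVneq (l2norm (proj ocM y)) 0.
  by move=> _; rewrite expr0n /= mulr_ge0 ?sqr_ge0 ?sqn_ge0.
have pp : 0 < l2norm (proj ocM y) by rewrite lt_def p0 l2norm_ge0.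
rewrite expr2 mulrCA ler_pM2l // => h.
by rewrite -expr2 -l2norm_sq -exprMn ler_pXn2r ?nnegrE ?mulr_ge0 ?l2norm_ge0 ?c0_ge0.
Qed.

(** By Pythagoras [sqn (y - P y)] is at most [sqn (x + y)], and it is at least
    [sqn y - sqn (P y) >= (1 - c^2) sqn y]. *)
Lemma angle_lower_bound : c0 M N < 1 -> exists2 k, 0 < k &
  forall x y, M x -> N y -> k * sqn y <= sqn (x + y).
Proof.
move=> c1; have c_ge0 := c0_ge0; exists (1 - c0 M N ^+ 2); first by nra.
move=> x y Mx Ny; have ly := submod_l2 smN Ny; have lx := submod_l2 smM Mx.
have lp : l2 (proj ocM y) := proj_l2 smM ly; have lyp := l2B ly lp.
have h1 : sqn (y - proj ocM y) <= sqn (x + y).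
  rewrite /sqn (proj_pythagoras smM ocM ly Mx) [in leRHS]addrC.
  by apply: cnorm_pos_mono; apply: inner_pos => //; exact: l2D.
have h2 : sqn y <= sqn (proj ocM y) + sqn (y - proj ocM y).
  have := proj_pythagoras smM ocM ly (submod0 smM); rewrite !add0r => E.
  by rewrite {1}/sqn E cnormD.
have := sqn_proj_le Ny; lra.
Qed.

(** * Alternating projections *)

Section AlternatingProjections.
Variable k : R.
Hypothesis (Hk : forall x y, M x -> N y -> k * sqn y <= sqn (x + y)).
Variable y : nat -> A.
Hypothesis Ny : N y.

Fixpoint altproj n : nat -> A := if n is n'.+1 then
  (if odd n' then proj ocN (altproj n') else proj ocM (altproj n')) else y.

Let v := altproj.
Let a n := inner (v n) (v n).

Lemma altproj_l2 n : l2 (v n).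
Proof.
rewrite /v; elim: n => [|n IH] /=; first exact: submod_l2 Ny.
by case: ifP => _; [apply: (proj_l2 smN)|apply: (proj_l2 smM)].
Qed.
Arguments altproj_l2 : clear implicits.

Lemma altproj_even n : ~~ odd n -> N (v n).
Proof.
case: n => [//|n] /=; rewrite negbK /v /= => ->.
exact: proj_mem (altproj_l2 n).
Qed.

Lemma altproj_odd n : odd n -> M (v n).
Proof.
case: n => [//|n] /= /negbTE; rewrite /v /= => ->.
exact: proj_mem (altproj_l2 n).
Qed.

Lemma inner_altproj_succ n : inner (v n) (v n.+1) = a n.+1.
Proof.
have lv := altproj_l2 n; have lv1 := altproj_l2 n.+1.
rewrite -inner_star // -[RHS]inner_star //; congr star.
rewrite /a /v /=; case: ifP => on.
  by rewrite (inner_proj smN) //; exact: proj_mem.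
by rewrite (inner_proj smM) //; exact: proj_mem.
Qed.

Lemma inner_altproj_succ2 n : inner (v n) (v n.+2) = a n.+1.
Proof.
rewrite -inner_altproj_succ; have lv1 := altproj_l2 n.+1.
have [on|en] := boolP (odd n).
  have -> : v n.+2 = proj ocM (v n.+1) by rewrite /v /= on.
  by rewrite (inner_proj smM) //; exact: altproj_odd.
have -> : v n.+2 = proj ocN (v n.+1) by rewrite /v /= en.
by rewrite (inner_proj smN) //; exact: altproj_even.
Qed.

Let b n := a n - a n.+1.

Lemma altproj_drop n : b n = inner (v n - v n.+1) (v n - v n.+1).
Proof.
have lv := altproj_l2 n; have lv1 := altproj_l2 n.+1.
rewrite innerBl ?innerBr //; last exact: l2B.
rewrite inner_altproj_succ -[inner (v n.+1) (v n)]inner_star // inner_altproj_succ.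
by rewrite /a inner_star // -/(a n.+1) subrr subr0.
Qed.

(** Convexity of [a]: the second difference [a n - 2 a n.+1 + a n.+2] is the inner square of
    [v n - v n.+2]. *)
Lemma altproj_drop_decr n : pos (b n - b n.+1).
Proof.
have lv := altproj_l2 n; have lv2 := altproj_l2 n.+2.
have := inner_pos (l2B lv lv2).
rewrite innerBl ?innerBr //; last exact: l2B.
rewrite inner_altproj_succ2 -[inner (v n.+2) (v n)]inner_star // inner_altproj_succ2.
by rewrite {1}/a inner_star; [ | exact: altproj_l2 | exact: altproj_l2].
Qed.

(** [a 0 - a n] is the sum of the drops [b j] for [j < n], each at least [b n]. *)
Lemma altproj_drop_sum n : pos (a 0 - a n - n%:R%:C *: b n).
Proof.
elim: n => [|n IH]; first by rewrite scale0r subrr subr0; exact: pos0.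
have -> : a 0 - a n.+1 - n.+1%:R%:C *: b n.+1 =
    (a 0 - a n - n%:R%:C *: b n) + n.+1%:R%:C *: (b n - b n.+1).
  rewrite [_ *: (b n - _)]scalerBr addrA; congr (_ - _).
  rewrite -[n.+1%:R]natr1 rmorphD scalerDl /= scale1r addrA subrK.
  by rewrite /b subrKA.
by apply: posD IH (posZ _ (altproj_drop_decr n)).
Qed.

(** For even [n], [v n] lies in [N], and [Hk] at [x = - v n.+1] gives [k sqn (v n) <= |b n|]; then
    [n b n <= a 0 - a n <= a 0]. *)
Lemma altproj_decay n : ~~ odd n -> n%:R * k * sqn (v n) <= sqn y.
Proof.
move=> en; have Nv := altproj_even en; have lv := altproj_l2 n.
have h1 : k * sqn (v n) <= cnorm (b n).
  have Mp := proj_mem ocM lv.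
  have := Hk (submodN smM Mp) Nv; rewrite altproj_drop /v /= (negbTE en).
  by rewrite addrC.
have lpos : pos (n%:R%:C *: b n).
  by apply: posZ => //; rewrite altproj_drop; apply: inner_pos; apply: l2B => //; exact: altproj_l2.
have := cnorm_pos_mono lpos (posD (altproj_drop_sum n) (inner_pos lv)).
rewrite -/(a n) addrA [_ + (_ - _)]addrC subrK subrK cnormZr ger0_norm // -/(sqn y) => h2.
rewrite -mulrA (le_trans _ h2) //.
by rewrite ler_wpM2l.
Qed.

Lemma altproj_log_convex n : sqn (v n.+1) ^+ 2 <= sqn (v n) * sqn (v n.+2).
Proof.
rewrite {1}/sqn -/(a n.+1) -inner_altproj_succ2.
exact: inner_cauchy_schwarz (altproj_l2 n) (altproj_l2 n.+2).
Qed.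

(** Log-convexity makes the successive ratios of [sqn (v n)] nondecreasing, so the first is the
    least. Cross-multiplication allows zero terms. *)
Lemma altproj_ratio n : sqn (v 1) * sqn (v n) <= sqn y * sqn (v n.+1).
Proof.
elim: n => [|n IH]; first by rewrite mulrC.
have h := altproj_log_convex n.
have p m : 0 <= sqn (v m) by exact: sqn_ge0.
have y0 : 0 <= sqn y by exact: sqn_ge0.
have [e|ne] := eqVneq (sqn (v n.+1)) 0.
  by rewrite e mulr0 mulr_ge0.
have vp : 0 < sqn (v n.+1) by rewrite lt_def ne p.
rewrite -(ler_pM2l vp).
have h1 := ler_wpM2l (p 1%N) h.
have h2 := ler_wpM2r (p n.+2) IH.
nra.
Qed.

Lemma altproj_power n : sqn (v 1) ^+ n.+1 <= sqn y ^+ n * sqn (v n.+1).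
Proof.
elim: n => [|n IH]; first by rewrite expr1 expr0 mul1r.
rewrite exprS (le_trans (ler_wpM2l (sqn_ge0 _) IH)) // mulrCA exprSr -mulrA.
by rewrite ler_wpM2l ?exprn_ge0 ?sqn_ge0 // altproj_ratio.
Qed.

(** Decay gives [sqn (v n) <= sqn y / 2], so the ratio of [sqn (v 1)] to [sqn y] has [n]-th power at
    most [1 / 2], while [(1 - 1 / (2 n))^n >= 1 / 2] by Bernoulli. *)
Lemma sqn_proj_contraction n : ~~ odd n -> (0 < n)%N -> 2 <= n%:R * k ->
  sqn (proj ocM y) <= (1 - (2 * n%:R)^-1) * sqn y.
Proof.
move=> en n0 nk.
have bern (x : R) j : 0 <= x <= 1 -> 1 - j%:R * x <= (1 - x) ^+ j.
  move=> /andP[x0 x1]; elim: j => [|j IH]; first by rewrite mul0r subr0 expr0.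
  rewrite exprS; apply: le_trans (ler_wpM2l _ IH); last lra.
  rewrite -natr1; have : 0 <= j%:R :> R by []. nra.
have nn : 0 < n%:R :> R by rewrite ltr0n.
pose w : R := (2 * n%:R)^-1; rewrite -/w.
have h2n : 0 <= w <= 1.
  rewrite /w invr_ge0 mulr_ge0 //= invf_le1 ?mulr_gt0 //.
  by rewrite -natrM ler1n muln_gt0.
have [y0|yn] := eqVneq (sqn y) 0.
  have := altproj_log_convex 0; rewrite /v /= y0 mul0r mulr0 => h.
  have : sqn (proj ocM y) = 0 by apply/eqP; rewrite -sqrf_eq0 eq_le h sqr_ge0.
  by move->.
have yp : 0 < sqn y by rewrite lt_def yn sqn_ge0.
have pw : sqn (v 1) ^+ n <= sqn y ^+ n / 2.
  have := altproj_power n.-1; rewrite prednK // => /le_trans; apply.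
  have := altproj_decay en => h.
  have h3 : sqn (v n) <= sqn y / 2.
    have := sqn_ge0 (v n); nra.
  rewrite (le_trans (ler_wpM2l _ h3)) ?exprn_ge0 ?sqn_ge0 //.
  by rewrite mulrA -exprSr prednK.
rewrite -[proj ocM y]/(v 1) leNgt; apply/negP => hlt.
have q0 : 0 <= (1 - w) * sqn y by rewrite mulr_ge0 ?sqn_ge0 //; lra.
have : ((1 - w) * sqn y) ^+ n < sqn (v 1) ^+ n.
  by rewrite ltr_pXn2r // nnegrE ?sqn_ge0.
rewrite exprMn.
have := bern _ n h2n.
have -> : n%:R * w = 2^-1 by rewrite /w; field; rewrite gt_eqF.
have := exprn_gt0 n yp; nra.
Qed.

End AlternatingProjections.

Lemma lower_bound_angle k : 0 < k ->
  (forall x y, M x -> N y -> k * sqn y <= sqn (x + y)) -> c0 M N < 1.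
Proof.
move=> k0 Hk.
(* An even [n] with [n k >= 2], as [sqn_proj_contraction] requires. *)
pose n := (2 * (Num.bound (k^-1)).+1)%N.
have en : ~~ odd n by rewrite /n mul2n odd_double.
have n0 : (0 < n)%N by [].
have nk : 2 <= n%:R * k.
  rewrite /n natrM -mulrA ler_peMr // -ler_pdivrMr // div1r.
  rewrite ltW // (lt_trans (archi_boundP _)) ?invr_ge0 ?ltW // ltr_nat //.
pose q := 1 - (2 * n%:R)^-1 : R.
have q1 : q < 1 by rewrite /q gtrBl invr_gt0 mulr_gt0 // ltr0n.
(* The contraction bounds squared norms by [q], while [c0] is bounded through
   [|<x, y>| = |<x, P y>| <= |P y|]. *)
apply: le_lt_trans (_ : Num.sqrt q < 1); last first.
  by rewrite -sqrtr1 ltr_sqrt.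
apply: c0_le => x y Mx Ny x1 y1.
have ly := submod_l2 smN Ny; have lx := submod_l2 smM Mx.
have lp : l2 (proj ocM y) := proj_l2 smM ly.
rewrite -(inner_proj smM ocM ly Mx).
rewrite (le_trans (cnorm_inner_le lx lp)) // -[leRHS]mul1r ler_pM ?l2norm_ge0 //.
rewrite /l2norm ler_wsqrtr // -/(sqn _) (le_trans (sqn_proj_contraction Hk Ny en n0 nk)) //.
rewrite -/q; move: y1; rewrite l2norm_le1 => y1.
have : 0 <= q; last by have := sqn_ge0 y; nra.
rewrite /q subr_ge0 invf_le1 ?mulr_gt0 ?ltr0n //.
by rewrite -natrM ler1n muln_gt0.
Qed.

End DixmierAngle.

Theorem lemma3p17 (R : realType) (A : unitalCStarType R) (M N : set (nat -> A))
    (clM : closed_submodule M) (clN : closed_submodule N)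
    (ocM : orthogonally_complementable M) (ocN : orthogonally_complementable N)
    (MN0 : M `&` N = [set 0]) :
  norm_closed (sumset M N) <-> positive_dixmier_angle M N.
Proof.
split=> [ncZ|c1].
  have [k k0 Hk] := closed_sum_lower_bound clM clN ncZ MN0.
  exact (lower_bound_angle clM clN ocM ocN k0 Hk).
have [k k0 Hk] := angle_lower_bound clM clN ocM c1.
exact (sum_closed_of_lower_bound clM clN k0 Hk).
Qed.
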